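(* Let $W(3,2,2)$ be a three-web of codimension two on a four-dimensional manifold $M^4$ with nowhere vanishing covector $a=\{a_i\}$. The integral surfaces $V^2$ of the transversal $a$-distribution $\Delta$ are geodesicly parallel with respect to any affine connection of the bundle of affine connections defined by the forms $$\begin{pmatrix}\theta_j^i&0\\0&\theta_j^i\end{pmatrix},\qquad \theta_j^i=\omega_j^i+a^i_{jk}\bigl(p\,\omega_{(1)}^k+q\,\omega_{(2)}^k\bigr),\quad i,j=1,2$$ ($p,q$ parameters) if and only if the components of the covector $a$ and of the tensors $p_{ij}$ and $q_{ij}$ satisfy (in a general admissible frame) the conditions $$a_2p_{12}-a_1p_{22}=0,\quad a_1p_{21}-a_2p_{11}=0,\quad a_2q_{12}-a_1q_{22}=0,\quad a_1q_{21}-a_2q_{11}=0 .$$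
   Context: A web $W(3,2,2)$ on a 4-manifold $M^4$ consists of three foliations $\lambda_1,\lambda_2,\lambda_3$ of codimension 2 in general position (their tangent planes are pairwise transversal at each point). All considerations are local. Indices $i,j,k,l$ range over $\{1,2\}$; repeated indices are summed; square brackets around indices denote alternation with averaging. The foliation $\lambda_u$ is given by $\omega_{(u)}^i=0$, $i=1,2$, where the 1-forms are normalized so that $\omega_{(1)}^i+\omega_{(2)}^i+\omega_{(3)}^i=0$; the forms $\omega_{(1)}^i,\omega_{(2)}^i$ form a coframe on $M^4$. Admissible coframe changes are $\omega_{(\alpha)}^{i'}=A^{i'}_j\omega_{(\alpha)}^j$ with the same nondegenerate matrix for $\alpha=1,2$. The structure equations are $$d\omega_{(1)}^i=\omega_{(1)}^j\wedge\omega_j^i+a_j\omega_{(1)}^j\wedge\omega_{(1)}^i,\qquad d\omega_{(2)}^i=\omega_{(2)}^j\wedge\omega_j^i-a_j\omega_{(2)}^j\wedge\omega_{(2)}^i,$$ which determine the connection forms $\omega_j^i$ and the covector $a=\{a_1,a_2\}$; the torsion tensor is $a^i_{jk}=a_{[j}\delta^i_{k]}$. Further, $$d\omega_j^i-\omega_j^k\wedge\omega_k^i=b^i_{jkl}\,\omega_{(1)}^k\wedge\omega_{(2)}^l,\qquad da_i-a_j\omega_i^j=p_{ij}\omega_{(1)}^j+q_{ij}\omega_{(2)}^j,$$ which defines the tensors $p_{ij},q_{ij}$ (Pfaffian derivatives of $a$). The transversal $a$-distribution $\Delta$ is defined by $a_1\omega_{(1)}^1+a_2\omega_{(1)}^2=0$,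 $a_1\omega_{(2)}^1+a_2\omega_{(2)}^2=0$. Let $\{e_i^\alpha\}$ ($i,\alpha=1,2$) be the vector frame dual to $\{\omega_{(\alpha)}^i\}$. In the affine connection with the forms $\theta_j^i$ one has $\nabla e_i^\alpha=\theta_i^j e_j^\alpha$ for $\alpha=1,2$. The integral surfaces of $\Delta$ are geodesicly parallel in such a connection if $\Delta$ is integrable and is parallel on all of $M^4$, i.e. $\nabla_XY\in\Delta$ for every section $Y$ of $\Delta$ and every vector $X$ tangent to $M^4$. *)

(* Defs.v *)
From mathcomp Require Import all_boot all_order all_algebra.
From mathcomp Require Import all_classical all_reals topology normedtype derive.

Set Implicit Arguments.
Unset Strict Implicit.
Unset Printing Implicit Defensive.

Import Order.TTheory GRing.Theory Num.Theory.
Import numFieldNormedType.Exports.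

Local Open Scope classical_set_scope.
Local Open Scope ring_scope.

(* All considerations being local, the manifold M^4 is an open subset of the
   coordinate space R^4, and each tangent space is identified with R^4.
   Indices 1, 2 (resp. 1, 2, 3) are the elements 0, 1 of 'I_2 (resp. 0, 1, 2
   of 'I_3). *)

Section Calculus.
Context {R : realType}.

Fixpoint Ck {n : nat} {W : normedModType R} (k : nat) (A : set 'rV[R]_n.+1)
    (f : 'rV[R]_n.+1 -> W) : Prop :=
  match k with
  | 0 => forall x, A x -> {for x, continuous f}
  | k'.+1 => (forall x, A x -> differentiable f x) /\
             forall i, Ck k' A (fun x => 'D_(delta_mx 0 i) f x)
  end.

(* meant for open A *)
Definition smooth {n : nat} {W : normedModType R} (A : set 'rV[R]_n.+1)
    (f : 'rV[R]_n.+1 -> W) : Prop :=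
  forall k, Ck k A f.

Definition form1 := 'rV[R]_4 -> 'cV[R]_4.

Definition form2 := 'rV[R]_4 -> 'rV[R]_4 -> 'rV[R]_4 -> R.

Definition ev (w : form1) (x v : 'rV[R]_4) : R := (v *m w x) 0 0.

(* d w (X, Y) = X (w Y) - Y (w X) - w [X, Y], for X, Y the constant fields
   u, v *)
Definition ext_d (w : form1) : form2 := fun x u v =>
  'D_u (fun z => ev w z v) x - 'D_v (fun z => ev w z u) x.

Definition wedge (w w' : form1) : form2 := fun x u v =>
  ev w x u * ev w' x v - ev w x v * ev w' x u.

Definition distribution := 'rV[R]_4 -> set 'rV[R]_4.

(* T is the tangent distribution of a foliation of codimension k.+1 of M: near
   every point, the leaves are the level sets of a submersion onto R^k.+1. *)
Definition foliation (k : nat) (M : set 'rV[R]_4) (T : distribution) : Prop :=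
  forall x, M x ->
  exists (V : set 'rV[R]_4) (f : 'rV[R]_4 -> 'rV[R]_k.+1),
    [/\ open V, V x, V `<=` M, smooth V f &
        forall y, V y -> \rank ('J f y) = k.+1 /\
                         T y = [set v | 'd f y v = 0]].

(* Through every point of M there passes an immersed (k.+1)-dimensional surface
   whose tangent space at each of its points is given by D. *)
Definition integrable (k : nat) (M : set 'rV[R]_4) (D : distribution) : Prop :=
  forall x, M x ->
  exists (N : set 'rV[R]_k.+1) (s : 'rV[R]_k.+1 -> 'rV[R]_4),
    [/\ open N, N 0, smooth N s, s 0 = x &
        forall h, N h -> [/\ M (s h), \rank ('J s h) = k.+1 &
                             D (s h) = range ('d s h)]].

End Calculus.

Arguments form1 R : clear implicits.
Arguments distribution R : clear implicits.

Section Web.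
Context {R : realType}.

(* A web W(3,2,2) on M; lam u x is the tangent plane at x of the leaf of the
   foliation lambda_u through x. *)
Definition web322 (M : set 'rV[R]_4) (lam : 'I_3 -> distribution R) : Prop :=
  [/\ open M,
      forall u, foliation 1 M (lam u) &
      forall u v x, u != v -> M x -> lam u x `&` lam v x = [set 0]].

(* The 1-forms w u i = omega_(u)^i, u = 1, 2, 3. *)
Definition admissible_coframe (M : set 'rV[R]_4) (lam : 'I_3 -> distribution R)
    (w : 'I_3 -> 'I_2 -> form1 R) : Prop :=
  [/\ forall u i, smooth M (w u i),
      forall u x, M x -> lam u x = [set v | forall i, ev (w u i) x v = 0] &
      forall i x, M x -> \sum_(u < 3) w u i x = 0].

(* al = 1, 2 as one of the three labels 1, 2, 3 *)
Definition fam (al : 'I_2) : 'I_3 := widen_ord (leqnSn 2) al.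

(* e al i = e_i^al *)
Definition dual_frame (M : set 'rV[R]_4) (w : 'I_3 -> 'I_2 -> form1 R)
    (e : 'I_2 -> 'I_2 -> 'rV[R]_4 -> 'rV[R]_4) : Prop :=
  (forall al i, smooth M (e al i)) /\
  forall al be i j x, M x ->
    ev (w (fam al) i) x (e be j x) = ((al == be) && (i == j))%:R.

(* om j i = omega_j^i: the lower index comes first *)
Definition structure_equations (M : set 'rV[R]_4) (w : 'I_3 -> 'I_2 -> form1 R)
    (om : 'I_2 -> 'I_2 -> form1 R) (a : 'I_2 -> 'rV[R]_4 -> R) : Prop :=
  [/\ forall j i, smooth M (om j i),
      forall i, smooth M (a i),
      forall i x u v, M x ->
        ext_d (w 0 i) x u v =
          \sum_j wedge (w 0 j) (om j i) x u v +
          \sum_j a j x * wedge (w 0 j) (w 0 i) x u v &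
      forall i x u v, M x ->
        ext_d (w 1 i) x u v =
          \sum_j wedge (w 1 j) (om j i) x u v -
          \sum_j a j x * wedge (w 1 j) (w 1 i) x u v].

(* b i j k l = b^i_jkl *)
Definition curvature_equations (M : set 'rV[R]_4) (w : 'I_3 -> 'I_2 -> form1 R)
    (om : 'I_2 -> 'I_2 -> form1 R)
    (b : 'I_2 -> 'I_2 -> 'I_2 -> 'I_2 -> 'rV[R]_4 -> R) : Prop :=
  forall i j x u v, M x ->
    ext_d (om j i) x u v - \sum_k wedge (om j k) (om k i) x u v =
      \sum_k \sum_l b i j k l x * wedge (w 0 k) (w 1 l) x u v.

(* P i j = p_ij and Q i j = q_ij *)
Definition pfaffian_derivatives (M : set 'rV[R]_4)
    (w : 'I_3 -> 'I_2 -> form1 R) (om : 'I_2 -> 'I_2 -> form1 R)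
    (a : 'I_2 -> 'rV[R]_4 -> R) (P Q : 'I_2 -> 'I_2 -> 'rV[R]_4 -> R) : Prop :=
  forall i x v, M x ->
    'D_v (a i) x - \sum_j a j x * ev (om i j) x v =
      \sum_j P i j x * ev (w 0 j) x v + \sum_j Q i j x * ev (w 1 j) x v.

(* a^i_jk = a_[j delta^i_k], alternation being normalized by 1/2 *)
Definition torsion (a : 'I_2 -> 'rV[R]_4 -> R) (i j k : 'I_2)
    (x : 'rV[R]_4) : R :=
  (a j x * (i == k)%:R - a k x * (i == j)%:R) / 2.

(* theta_j^i, lower index first *)
Definition bundle_form (w : 'I_3 -> 'I_2 -> form1 R)
    (om : 'I_2 -> 'I_2 -> form1 R) (a : 'I_2 -> 'rV[R]_4 -> R) (p q : R)
    (j i : 'I_2) : form1 R :=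
  fun x => om j i x +
           \sum_k torsion a i j k x *: (p *: w 0 k x + q *: w 1 k x).

Definition transversal_distribution (w : 'I_3 -> 'I_2 -> form1 R)
    (a : 'I_2 -> 'rV[R]_4 -> R) : distribution R :=
  fun x => [set v | \sum_i a i x * ev (w 0 i) x v = 0 /\
                    \sum_i a i x * ev (w 1 i) x v = 0].

(* nabla_v Y at x for the affine connection with nabla e_i^al = th_i^j e_j^al,
   al = 1, 2: expand Y = omega_(al)^i(Y) e_i^al and apply the Leibniz rule. *)
Definition covariant (w : 'I_3 -> 'I_2 -> form1 R)
    (e : 'I_2 -> 'I_2 -> 'rV[R]_4 -> 'rV[R]_4) (th : 'I_2 -> 'I_2 -> form1 R)
    (x v : 'rV[R]_4) (Y : 'rV[R]_4 -> 'rV[R]_4) : 'rV[R]_4 :=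
  \sum_al \sum_i
    ('D_v (fun z => ev (w (fam al) i) z (Y z)) x +
     \sum_j ev (th j i) x v * ev (w (fam al) j) x (Y x)) *: e al i x.

Definition parallel_distribution (M : set 'rV[R]_4)
    (w : 'I_3 -> 'I_2 -> form1 R)
    (e : 'I_2 -> 'I_2 -> 'rV[R]_4 -> 'rV[R]_4) (th : 'I_2 -> 'I_2 -> form1 R)
    (D : distribution R) : Prop :=
  forall Y : 'rV[R]_4 -> 'rV[R]_4,
    smooth M Y -> (forall x, M x -> D x (Y x)) ->
    forall x v, M x -> D x (covariant w e th x v Y).

Definition geodesicly_parallel (M : set 'rV[R]_4)
    (w : 'I_3 -> 'I_2 -> form1 R)
    (e : 'I_2 -> 'I_2 -> 'rV[R]_4 -> 'rV[R]_4) (th : 'I_2 -> 'I_2 -> form1 R)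
    (D : distribution R) : Prop :=
  integrable 1 M D /\ parallel_distribution M w e th D.

End Web.

(* Main.v *)
(** Write n = (a_2, -a_1) for the kernel of the covector a, so that Delta is
    spanned by the two fields n^i e_i^al.  Since a_i a^i_jk = 0, the terms in p
    and q drop out of a_i theta_j^i, and Delta is parallel if and only if
    n^i (da_i - a_j omega_i^j) = 0, that is n^i p_ij = n^i q_ij = 0.  These
    conditions also make the forms a_i omega_(al)^i divide their own
    differentials, hence Delta is involutive; its integrability is then
    Frobenius' theorem.

    For the latter, normalize a frame of Delta by a constant matrix L, so that
    the new frame X satisfies X L = 1 and hence consists of commuting fields.
    If g_u is the integral curve of u X through x, then
    delta(t) = g_(u+v)(t) - g_u(t) - t v X(g_u(t)) satisfies, by commutation,
    |delta'| <= |delta| / 2 + C |v|^2 for small u, so that u |-> g_u(1) is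
    differentiable with derivative v |-> v X.  Its smoothness follows by
    iterating this identity. *)

Require Import Defs.
From mathcomp Require Import all_boot all_order all_algebra.
From mathcomp Require Import all_classical all_reals topology normedtype derive.
From mathcomp Require Import landau sequences measure lebesgue_measure.
From mathcomp Require Import lebesgue_integral ftc ring lra.
Import Order.TTheory GRing.Theory Num.Theory numFieldNormedType.Exports.
Local Open Scope classical_set_scope.
Local Open Scope ring_scope.

Set Implicit Arguments.
Unset Strict Implicit.
Unset Printing Implicit Defensive.

(** * Entrywise norms, derivatives and mean value estimates for matrix-valued maps *)

Lemma mx_norm_leP (R : realType) m n (A : 'M[R]_(m.+1, n.+1)) (c : R) :
  `|A| <= c <-> forall i j, `|A i j| <= c.
Proof.
rewrite [`|A|]/Num.Def.normr/= mx_normrE; split=> [H i j|H].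
  by apply: le_trans H; exact: (le_bigmax _ (fun ij => `|A ij.1 ij.2|) (i, j)).
by apply: bigmax_le => //; exact: le_trans (normr_ge0 (A 0 0)) (H _ _).
Qed.

Lemma mx_entry_le (R : realType) m n (A : 'M[R]_(m.+1, n.+1)) i j : `|A i j| <= `|A|.
Proof. exact: (mx_norm_leP A `|A|).1. Qed.

Lemma mulmx_norm_le (R : realType) m n p
    (A : 'M[R]_(m.+1, n.+1)) (B : 'M[R]_(n.+1, p.+1)) :
  `|A *m B| <= n.+1%:R * `|A| * `|B|.
Proof.
apply/mx_norm_leP => i j; rewrite mxE (le_trans (ler_norm_sum _ _ _))//.
rewrite (le_trans (ler_sum _ (G := fun=> `|A| * `|B|) _)) //.
  by move=> k _; rewrite normrM ler_pM// mx_entry_le.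
by rewrite sumr_const card_ord -[leLHS]mulr_natl mulrA.
Qed.

Lemma is_derive_mxP (R : realType) (V : normedModType R) m n
    (f : V -> 'M[R]_(m.+1, n.+1)) (t v : V) (df : 'M[R]_(m.+1, n.+1)) :
  is_derive t v f df <-> forall i j, is_derive t v (fun z => f z i j) (df i j).
Proof.
split=> [[fd fE] i j|H].
  have fd' := (derivable_mxP f t v).1 fd; split; first exact: fd'.
  by rewrite -fE derive_mx// mxE.
have fd : derivable f t v by apply/derivable_mxP => i j; case: (H i j).
by split=> //; rewrite derive_mx//; apply/matrixP => i j; rewrite mxE; case: (H i j).
Qed.

(** The norm is the maximum of the entries, so the scalar mean value theorem applied to each entry
    costs no constant, even though the intermediate points differ. *)
Lemma mean_value_le (R : realType) m n (f df : R -> 'M[R]_(m.+1, n.+1)) (a b C : R) :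
  a <= b -> (forall t, a <= t <= b -> {for t, continuous f}) ->
  (forall t, a < t < b -> is_derive t 1 f (df t)) ->
  (forall t, a < t < b -> `|df t| <= C) ->
  `|f b - f a| <= C * (b - a).
Proof.
rewrite le_eqVlt => /predU1P[<-|ab] fc fd fC; first by rewrite !subrr normr0 mulr0.
apply/mx_norm_leP => i j; rewrite !mxE.
have /= [| |c cab ->] := @MVT R (fun t => f t i j) (fun t => df t i j) a b ab.
- by move=> t; rewrite in_itv/= => /fd/is_derive_mxP.
- apply: continuous_in_subspaceT => t; rewrite inE/= in_itv/= => /fc tc.
  by apply: (@continuous_comp _ _ _ f (fun M : 'M_(_, _) => M i j)) => //; exact: coord_continuous.
have ba : 0 <= b - a by rewrite subr_ge0 ltW.
rewrite normrM (ger0_norm ba) ler_wpM2r//.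
by move: cab; rewrite in_itv/= => /fC; exact: le_trans (mx_entry_le _ _ _).
Qed.

(** Takes the place of Gronwall's inequality: at a point [c] where the norm of [f] is maximal on
    [0, 1], the mean value estimate on [0, c] gives [|f c| <= |f c| / 2 + C], because [c <= 1]. *)
Lemma small_growth (R : realType) m n (f df : R -> 'M[R]_(m.+1, n.+1)) (C : R) :
  0 <= C -> f 0 = 0 -> (forall t : R, 0 <= t <= 1 -> {for t, continuous f}) ->
  (forall t : R, 0 < t < 1 -> is_derive t 1 f (df t)) ->
  (forall t : R, 0 < t < 1 -> `|df t| <= `|f t| / 2 + C) ->
  forall t : R, 0 <= t <= 1 -> `|f t| <= 2 * C.
Proof.
move=> C0 f0 fc fd fC.
have [|c] := @EVT_max R (fun t => `|f t|) 0 1 ler01.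
  apply: continuous_in_subspaceT => t; rewrite inE/= in_itv/= => /fc tc.
  exact: (continuous_comp tc (@norm_continuous _ _ _)).
rewrite in_itv/= => /andP[c0 c1] cmax t t01.
have {}cmax s : 0 <= s <= 1 -> `|f s| <= `|f c| by move=> ?; apply: cmax; rewrite in_itv.
apply: le_trans (cmax _ t01) _.
have := @mean_value_le R m n f df 0 c (`|f c| / 2 + C) c0.
rewrite f0 !subr0 => H.
have {H} : `|f c| <= (`|f c| / 2 + C) * c.
  apply: H.
  - by move=> s /andP[s0 sc]; apply: fc; rewrite s0 (le_trans sc).
  - by move=> s /andP[s0 sc]; apply: fd; rewrite s0 (lt_le_trans sc).
  - move=> s /andP[s0 sc]; have s1 : s < 1 by apply: lt_le_trans c1.
    apply: le_trans (fC _ _) _; first by rewrite s0.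
    by rewrite lerD2r ler_pM2r ?invr_gt0//; apply: cmax; rewrite !ltW.
have fc0 := normr_ge0 (f c).
nra.
Qed.

(** * Picard iteration on the unit interval *)

Lemma antiderivative (R : realType) n (g : R -> 'rV[R]_n.+1) :
  continuous g ->
  exists2 G : R -> 'rV[R]_n.+1, G 0 = 0 &
    forall t : R, 0 <= t <= 1 -> is_derive t 1 G (g t).
Proof.
move=> gc; pose mu := @lebesgue_measure R.
have gjc j : continuous (fun t => g t 0 j).
  move=> t; apply: (@continuous_comp _ _ _ g (fun M : 'rV[R]_n.+1 => M 0 j)); first exact: gc.
  exact: coord_continuous.
(* Integrating from -1, inside the interval from -1 to 2, makes 0 and 1 interior points, so that
   two-sided derivatives exist there. *)
pose F j x := (\int[mu]_(t in `[-1, x]) g t 0 j)%R.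
have FD j (t : R) : 0 <= t <= 1 -> is_derive t 1 (F j) (g t 0 j).
  move=> /andP[t0 t1].
  have t2 : t < 2 by lra.
  have tN : -1 < t by lra.
  have [//||//||FD FE] := @continuous_FTC1_closed R (fun t => g t 0 j) (-1) t 2.
  - apply: continuous_compact_integrable; first exact: segment_compact.
    exact: continuous_subspaceT.
  - exact: gjc.
  by split; [exact: FD|rewrite -derive1E; exact: FE].
exists (fun t => \row_j (F j t - F j 0)).
  by apply/rowP => j; rewrite !mxE subrr.
move=> t t01; apply/is_derive_mxP => i j; rewrite ord1.
under eq_fun do rewrite mxE.
have -> : g t 0 j = g t 0 j - 0 by rewrite subr0.
by apply: (@is_deriveB _ _ _ (F j) (cst (F j 0))); exact: FD.
Qed.

(** The intervals from [a n] to [b n] below are nested, and the supremum of their left ends lies in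
    all of them. The rate is explicit, hence uniform in time when applied to Picard iterates. *)
Lemma geometric_cauchy (R : realType) (u : nat -> R) (B : R) :
  (forall n, `|u n.+1 - u n| <= B / 2 ^+ n) ->
  exists l, forall n, `|u n - l| <= 2 * B / 2 ^+ n.
Proof.
move=> uB; pose a n := u n - 2 * B / 2 ^+ n; pose b n := u n + 2 * B / 2 ^+ n.
have e n : 2 * B / 2 ^+ n.+1 = B / 2 ^+ n by rewrite exprS invfM mulrACA divff ?mul1r ?pnatr_eq0.
have e2 n : 2 * B / 2 ^+ n = 2 * (B / 2 ^+ n) by rewrite mulrA.
have B0 n : 0 <= B / 2 ^+ n by apply: le_trans (uB n).
have am : {homo a : i j / (i <= j)%N >-> i <= j}.
  apply: homo_leq => [//|n|n]; first exact: le_trans.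
  by rewrite /a e e2; move: (uB n); rewrite ler_norml => /andP[]; lra.
have bm : {homo b : i j / (i <= j)%N >-> j <= i}.
  apply: homo_leq => [//|n x y|n]; first by move=> *; apply: le_trans; eassumption.
  by rewrite /b e e2; move: (uB n); rewrite ler_norml => /andP[]; lra.
have ab i j : a i <= b j.
  apply: le_trans (am i (maxn i j) (leq_maxl _ _)) (le_trans _ (bm j (maxn i j) (leq_maxr _ _))).
  by rewrite /a /b e2; have := B0 (maxn i j); lra.
have ha : has_sup (range a).
  by split; [exists (a 0%N), 0%N | exists (b 0%N) => _ [i _ <-]; exact: ab].
exists (sup (range a)) => n; rewrite ler_norml.
have h1 : a n <= sup (range a) by apply: (ub_le_sup ha.2); exists n.
have h2 : sup (range a) <= b n by apply: (ge_sup ha.1) => _ [i _ <-]; exact: ab.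
by move: h1 h2; rewrite /a /b; lra.
Qed.

(** The retraction of the line onto [0, 1]: composing with it turns a curve controlled on [0, 1]
    into one that is continuous and bounded on the whole line. *)
Definition clamp01 (R : realType) (t : R) : R := Num.max 0 (Num.min 1 t).

Lemma clamp01_itv (R : realType) (t : R) : 0 <= clamp01 t <= 1.
Proof. by rewrite /clamp01 le_max lexx ge_max ler01 ge_min lexx. Qed.

Lemma clamp01_id (R : realType) (t : R) : 0 <= t <= 1 -> clamp01 t = t.
Proof. by move=> /andP[t0 t1]; rewrite /clamp01 min_r// max_r. Qed.

Lemma clamp01_continuous (R : realType) : continuous (@clamp01 R).
Proof.
move=> t; apply: continuous_max; first exact: cvg_cst.
by apply: continuous_min; [exact: cvg_cst|exact: cvg_id].
Qed.

Lemma lipschitz_ball_comp (R : realType) n (F : 'rV[R]_n.+1 -> 'rV[R]_n.+1)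
    (x : 'rV[R]_n.+1) (r : R) (u : R -> 'rV[R]_n.+1) :
  (forall z z', `|z - x| <= r -> `|z' - x| <= r -> `|F z - F z'| <= `|z - z'| / 2) ->
  continuous u -> (forall t, `|u t - x| <= r) -> continuous (fun t => F (u t)).
Proof.
move=> FL uc ur t; apply/cvgrPdist_lt => eps eps0.
near=> s; apply: le_lt_trans (FL _ _ (ur _) (ur _)) _.
have : `|u t - u s| < eps by near: s; exact: (@cvgr_dist_lt _ _ _ (nbhs t) _ u (u t) (uc t)).
by move=> h; rewrite ltr_pdivrMr//; apply: lt_le_trans h _; lra.
Unshelve. all: by end_near. Qed.

(** With Lipschitz constant 1/2 and time at most 1, the Picard operator halves uniform distances;
    the bound [r] on [F] keeps its values in the closed ball of radius [r]. *)
Lemma ode_solution (R : realType) n (F : 'rV[R]_n.+1 -> 'rV[R]_n.+1)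
    (x : 'rV[R]_n.+1) (r : R) :
  (forall z z', `|z - x| <= r -> `|z' - x| <= r -> `|F z - F z'| <= `|z - z'| / 2) ->
  (forall z, `|z - x| <= r -> `|F z| <= r) -> 0 <= r ->
  exists g : R -> 'rV[R]_n.+1,
    [/\ g 0 = x, continuous g, forall t, `|g t - x| <= r &
        forall t : R, 0 < t < 1 -> is_derive t 1 g (F (g t))].
Proof.
move=> FL Fr r0.
pose good (u : R -> 'rV[R]_n.+1) := continuous u /\ forall t, `|u t - x| <= r.
(* This characterizes [u'] as the clamped Picard image of [u]: initial value, constancy on either
   side of the unit interval, and derivative inside it. *)
pose next (u u' : R -> 'rV[R]_n.+1) :=
  [/\ u' 0 = x, forall t, u' t = u' (clamp01 t) &
      forall t : R, 0 < t < 1 -> is_derive t 1 u' (F (u t))].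
have good0 : good (cst x) by split=> [t|t]; [exact: cvg_cst | rewrite subrr normr0].
have step u : good u -> exists u', good u' /\ next u u'.
  move=> [uc ur]; have Fuc := lipschitz_ball_comp FL uc ur.
  have [G G0 GD] := antiderivative Fuc.
  have Gc (t : R) : 0 <= t <= 1 -> {for t, continuous G}.
    by move=> /GD[/derivable1_diffP/differentiable_continuous].
  have Gx (t : R) : 0 <= t <= 1 -> `|G t| <= r.
    move=> /andP[t0 t1]; have := @mean_value_le R 0 n G (fun s => F (u s)) 0 t r t0.
    rewrite G0 !subr0 => /(_ _ _ _)/le_trans; apply.
    - by move=> s /andP[s0 st]; apply: Gc; rewrite s0 (le_trans st).
    - by move=> s /andP[s0 st]; apply: GD; rewrite (ltW s0) ltW// (lt_le_trans st).
    - by move=> s _; exact: Fr.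
    - by rewrite ler_piMr.
  exists (fun t => x + G (clamp01 t)); split; split.
  - move=> t; apply: cvgD; first exact: cvg_cst.
    apply: (@continuous_comp _ _ _ (@clamp01 R) G); first exact: clamp01_continuous.
    exact/Gc/clamp01_itv.
  - by move=> t; rewrite addrC addKr; exact/Gx/clamp01_itv.
  - by rewrite clamp01_id ?lexx ?ler01// G0 addr0.
  - by move=> t; rewrite (clamp01_id (clamp01_itv t)).
  - move=> t /andP[t0 t1]; rewrite -[F _]add0r.
    apply: (@is_deriveD _ _ _ (cst x) (fun t => G (clamp01 t))).
    apply: (@near_eq_is_derive _ _ _ G); last by apply: GD; rewrite !ltW.
    near=> s; rewrite clamp01_id//; apply/andP; split; apply/ltW; near: s.
      exact: lt_nbhsr.
    exact: lt_nbhsl.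
have contr u v u' v' (d : R) : good u -> good v -> good u' -> good v' ->
    next u u' -> next v v' ->
    (forall t, `|u t - v t| <= d) -> forall t, `|u' t - v' t| <= d / 2.
  move=> gu gv gu' gv' [u0 uc uD] [v0 vc vD] uv t; rewrite uc vc.
  have /andP[c0 c1] := clamp01_itv t; set s := clamp01 t in c0 c1 *.
  have d0 : 0 <= d := le_trans (normr_ge0 _) (uv 0).
  have := @mean_value_le R 0 n (u' - v') (fun s => F (u s) - F (v s)) 0 s (d / 2) c0.
  rewrite !fctE u0 v0 subrr !subr0 => /(_ _ _ _)/le_trans; apply.
  - by move=> ? _; apply: continuousB; [exact: gu'.1|exact: gv'.1].
  - move=> z /andP[z0 zs]; have z1 := lt_le_trans zs c1.
    by apply: is_deriveB; [apply: uD|apply: vD]; rewrite z0.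
  - move=> z _; apply: le_trans (FL _ _ (gu.2 _) (gv.2 _)) _.
    by rewrite ler_pM2r ?invr_gt0.
  - by rewrite ler_piMr// divr_ge0.
(* Curves that are not [good] are sent to themselves, only to make [Phi] total. *)
have /choice[Phi PhiP] : forall u, exists u', good u -> good u' /\ next u u'.
  by move=> u; have [/step[u' ?]|ngu] := pselect (good u); [exists u'|exists u].
pose U k := iter k Phi (cst x).
have gU k : good (U k) by elim: k => [//|k IH] /=; exact: (PhiP _ IH).1.
have nU k : next (U k) (U k.+1) := (PhiP _ (gU k)).2.
have UB k t : `|U k.+1 t - U k t| <= r / 2 ^+ k.
  elim: k t => [t|k IH]; first by rewrite expr0 divr1; exact: (gU 1%N).2.
  rewrite exprSr invfM mulrA.
  by move=> t; exact: (contr (U k.+1) (U k) _ _ _ (gU _) (gU _) (gU _) (gU _) (nU _) (nU _)).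
have /choice[g gP] : forall t, exists g, forall k, `|U k t - g| <= 2 * r / 2 ^+ k.
  move=> t; have /choice[l lP] : forall j, exists l, forall k, `|U k t 0 j - l| <= 2 * r / 2 ^+ k.
    move=> j; apply: geometric_cauchy => k; apply: le_trans (UB k t).
    by have := mx_entry_le (U k.+1 t - U k t) 0 j; rewrite !mxE.
  exists (\row_j l j) => k; apply/mx_norm_leP => i j; rewrite !mxE ord1; exact: lP.
have small (eps : R) : 0 < eps -> exists k, 2 * r / 2 ^+ k < eps.
  move=> eps0.
  have half1 : `|2^-1 : R| < 1 by rewrite ger0_norm; lra.
  have /cvgr0_norm_lt/(_ eps eps0)[k _ kP] := @cvg_geometric R (2 * r) 2^-1 half1.
  exists k; have := kP k (leqnn k); rewrite /geometric /= exprVn.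
  by apply: le_lt_trans; exact: ler_norm.
have gg : good g.
  split=> t.
    apply/cvgrPdist_lt => eps eps0.
    have [k kP] := small (eps / 3) (divr_gt0 eps0 (ltr0n _ 3)).
    near=> s.
    have h1 := gP t k; have h2 := gP s k.
    have h3 : `|U k t - U k s| < eps / 3.
      near: s; apply: (@cvgr_dist_lt _ _ _ (nbhs t) _ (U k) (U k t)); first exact: (gU k).1.
      by rewrite divr_gt0.
    have -> : g t - g s = - (U k t - g t) + (U k t - U k s) + (U k s - g s).
      by rewrite opprB !subrKA.
    apply: le_lt_trans (ler_normD _ _) _; apply: le_lt_trans (lerD (ler_normD _ _) (lexx _)) _.
    by rewrite normrN; lra.
  apply/ler_addgt0Pr => eps /small[k kP].
  have -> : g t - x = - (U k t - g t) + (U k t - x) by rewrite opprB subrKA.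
  apply: le_trans (ler_normD _ _) _; rewrite normrN addrC lerD//; first exact: (gU k).2.
  exact: le_trans (gP t k) (ltW kP).
have [gg' ng] := PhiP _ gg.
(* [U k.+1] tends to [g] by construction, and to [Phi g] because a Picard step halves the distance
   between [U k] and [g]. *)
have gE : Phi g = g.
  apply/funext => t; apply/eqP; rewrite -subr_eq0 -normr_le0; apply/ler_addgt0Pr => eps eps0.
  have [k kP] := small (eps / 2) (divr_gt0 eps0 (ltr0n _ 2)).
  have h1 := contr (U k) g _ _ _ (gU _) gg (gU _) gg' (nU _) ng (gP ^~ k) t.
  have h2 := gP t k.+1; rewrite exprSr invfM mulrA in h2.
  have -> : Phi g t - g t = - (U k.+1 t - Phi g t) + (U k.+1 t - g t).
    by rewrite opprB subrKA.
  apply: le_trans (ler_normD _ _) _; rewrite normrN.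
  have : 0 <= 2 * r / 2 ^+ k by apply: le_trans (gP t k).
  by rewrite add0r; lra.
move: ng; rewrite gE => -[g0 _ gD].
by exists g; split => //; [exact: gg.1|exact: gg.2].
Unshelve. all: by end_near. Qed.

(** * Directional derivatives, Lipschitz and Taylor estimates on balls *)

Lemma derive_dirsum (R : realType) n (W : normedModType R) (f : 'rV[R]_n.+1 -> W) z v :
  differentiable f z -> 'D_v f z = \sum_j v 0 j *: 'D_(delta_mx 0 j) f z.
Proof.
move=> fz; rewrite deriveE// [in LHS](row_sum_delta v) linear_sum.
by apply: eq_bigr => j _; rewrite linearZ/= deriveE.
Qed.

Lemma norm_dirsum_le (R : realType) n m p (v : 'rV[R]_n.+1)
    (A : 'I_n.+1 -> 'M[R]_(m.+1, p.+1)) K :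
  (forall j, `|A j| <= K) -> `|\sum_j v 0 j *: A j| <= n.+1%:R * K * `|v|.
Proof.
move=> AK; rewrite (le_trans (ler_norm_sum _ _ _))//.
rewrite (le_trans (ler_sum _ (G := fun=> K * `|v|) _)) //.
  by move=> k _; rewrite normrZ mulrC ler_pM// mx_entry_le.
by rewrite sumr_const card_ord -[leLHS]mulr_natl mulrA.
Qed.

Lemma is_derive_comp_curve (R : realType) n (W : normedModType R)
    (f : 'rV[R]_n.+1 -> W) (g : R -> 'rV[R]_n.+1) (t : R) d :
  is_derive t 1 g d -> differentiable f (g t) ->
  is_derive t 1 (fun s => f (g s)) ('D_d f (g t)).
Proof.
move=> [gt gE] fgt; have gt' : differentiable g t by exact/derivable1_diffP.
have fg : differentiable (f \o g) t by exact: differentiable_comp.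
split; first exact/derivable1_diffP.
by rewrite -[LHS]/('D_1 (f \o g) t) deriveE// diff_comp//= -(@deriveE _ _ _ g t 1 gt') gE deriveE.
Qed.

Section ball_estimates.
Context (R : realType) (n p q : nat) (x : 'rV[R]_n.+1) (r : R).

Let seg (z z' : 'rV[R]_n.+1) (t : R) := z + t *: (z' - z).

Let seg_ball z z' (t : R) : `|z - x| <= r -> `|z' - x| <= r -> 0 <= t <= 1 ->
  `|seg z z' t - x| <= r.
Proof.
move=> zr z'r /andP[t0 t1].
have -> : seg z z' t - x = (1 - t) *: (z - x) + t *: (z' - x).
  apply/rowP => j; rewrite !mxE; ring.
apply: le_trans (ler_normD _ _) _; rewrite !normrZ (ger0_norm t0) ger0_norm ?subr_ge0//.
by have := ler_wpM2l t0 z'r; have := ler_wpM2l (_ : 0 <= 1 - t) zr; rewrite subr_ge0; lra.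
Qed.

Let seg_derive z z' (t : R) : is_derive t 1 (seg z z') (z' - z).
Proof.
have h : is_derive t 1 (fun s : R => s *: (z' - z)) (z' - z).
  apply: DeriveDef; first exact/derivable1_diffP.
  by rewrite deriveE// diff_val scale1r.
have := @is_deriveD _ _ _ (cst z) (fun s : R => s *: (z' - z)) t 1 _ _ (is_derive_cst _ _ _) h.
by rewrite add0r.
Qed.

Lemma lipschitz_ball (f : 'rV[R]_n.+1 -> 'M[R]_(p.+1, q.+1)) K z z' :
  (forall z, `|z - x| <= r -> differentiable f z) ->
  (forall z j, `|z - x| <= r -> `|'D_(delta_mx 0 j) f z| <= K) ->
  `|z - x| <= r -> `|z' - x| <= r -> `|f z' - f z| <= n.+1%:R * K * `|z' - z|.
Proof.
move=> fd fK zr z'r.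
have fs (t : R) : 0 <= t <= 1 ->
    is_derive t 1 (fun t => f (seg z z' t)) ('D_(z' - z) f (seg z z' t)).
  by move=> t01; apply: is_derive_comp_curve => //; apply/fd/seg_ball.
have := @mean_value_le R p q (fun t => f (seg z z' t)) (fun t => 'D_(z' - z) f (seg z z' t)) 0 1
  (n.+1%:R * K * `|z' - z|) ler01.
rewrite /seg scale0r scale1r addr0 [z + _]addrC subrK subr0 mulr1; apply.
- by move=> t /fs[/derivable1_diffP/differentiable_continuous].
- by move=> t /andP[t0 t1]; apply: fs; rewrite !ltW.
- move=> t /andP[t0 t1]; have tr : `|seg z z' t - x| <= r by apply: seg_ball => //; rewrite !ltW.
  by rewrite derive_dirsum; [apply: norm_dirsum_le => j; exact: fK|exact: fd].
Qed.

(** Along the segment, subtracting [t *: D] from [f] leaves a derivative that is a difference of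
    directional derivatives at two points. The Lipschitz estimate for the partial derivatives makes
    it quadratic in [z' - z]. *)
Lemma taylor_ball (f : 'rV[R]_n.+1 -> 'M[R]_(p.+1, q.+1)) K z z' :
  (forall z, `|z - x| <= r -> differentiable f z) ->
  (forall z j, `|z - x| <= r -> differentiable ('D_(delta_mx 0 j) f) z) ->
  (forall z j k, `|z - x| <= r ->
     `|'D_(delta_mx 0 k) ('D_(delta_mx 0 j) f) z| <= K) ->
  `|z - x| <= r -> `|z' - x| <= r ->
  `|f z' - f z - 'D_(z' - z) f z| <= n.+1%:R ^+ 2 * K * `|z' - z| ^+ 2.
Proof.
move=> fd fd2 fK zr z'r.
have fs (t : R) : 0 <= t <= 1 ->
    is_derive t 1 (fun t => f (seg z z' t)) ('D_(z' - z) f (seg z z' t)).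
  by move=> t01; apply: is_derive_comp_curve => //; apply/fd/seg_ball.
pose D := 'D_(z' - z) f z.
have ls (t : R) : is_derive t 1 (fun t => t *: D) D.
  apply: DeriveDef; first exact/derivable1_diffP.
  by rewrite deriveE// diff_val scale1r.
have fls (t : R) : 0 <= t <= 1 ->
    is_derive t 1 (fun t => f (seg z z' t) - t *: D) ('D_(z' - z) f (seg z z' t) - D).
  by move=> t01; apply: (@is_deriveB _ _ _ (fun t => f (seg z z' t)) (fun t => t *: D)); exact: fs.
have := @mean_value_le R p q (fun t => f (seg z z' t) - t *: D)
  (fun t => 'D_(z' - z) f (seg z z' t) - D) 0 1 (n.+1%:R ^+ 2 * K * `|z' - z| ^+ 2) ler01.
rewrite /seg !scale0r !scale1r addr0 [z + _]addrC subrK !subr0 mulr1 addrAC; apply.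
- by move=> t /fls[/derivable1_diffP/differentiable_continuous].
- by move=> t /andP[t0 t1]; apply: fls; rewrite !ltW.
- move=> t /andP[t0 t1]; have tr : `|seg z z' t - x| <= r by apply: seg_ball => //; rewrite !ltW.
  rewrite /D !derive_dirsum; [|exact: fd|exact: fd].
  rewrite -sumrB; under eq_bigr do rewrite -scalerBr.
  have -> : n.+1%:R ^+ 2 * K * `|z' - z| ^+ 2 = n.+1%:R * (n.+1%:R * K * `|z' - z|) * `|z' - z|.
    by ring.
  apply: norm_dirsum_le => j.
  apply: le_trans (@lipschitz_ball ('D_(delta_mx 0 j) f) K z (z + t *: (z' - z)) _ _ zr tr) _.
  + by move=> *; exact: fd2.
  + by move=> *; exact: fK.
  + have K0 : 0 <= K by apply: le_trans (fK z j j zr).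
    rewrite ler_wpM2l ?mulr_ge0 ?ler0n// /seg addrC addKr normrZ (ger0_norm (ltW t0)).
    by rewrite ler_piMl// ltW.
Qed.

End ball_estimates.

(** Collects under one radius and one constant every estimate that the study of integral curves
    needs. *)
Lemma Ck2_estimates (R : realType) n p q (M : set 'rV[R]_n.+1)
    (f : 'rV[R]_n.+1 -> 'M[R]_(p.+1, q.+1)) x :
  open M -> M x -> Ck 2 M f ->
  exists r K : R, [/\ 0 < r, 0 < K, forall z, `|z - x| <= r -> M z,
    forall z, `|z - x| <= r -> `|f z| <= K &
    [/\ forall z v, `|z - x| <= r -> `|'D_v f z| <= K * `|v|,
    forall z z', `|z - x| <= r -> `|z' - x| <= r -> `|f z' - f z| <= K * `|z' - z| &
    forall z z', `|z - x| <= r -> `|z' - x| <= r ->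
      `|f z' - f z - 'D_(z' - z) f z| <= K * `|z' - z| ^+ 2]].
Proof.
move=> oM Mx [fd /all_and2[fd1 fc2]].
have fc0 := differentiable_continuous (fd x Mx).
have fc1 j := differentiable_continuous (fd1 j x Mx).
pose D1 j := 'D_(delta_mx 0 j) f; pose D2 j k := 'D_(delta_mx 0 k) (D1 j).
(* All summands are nonnegative, so [K0] exceeds by at least 1 the norms at [x] of [f] and of its
   partial derivatives of order one and two; continuity keeps these norms below [K0] near [x]. *)
pose K0 := `|f x| + \sum_j `|D1 j x| + \sum_j \sum_k `|D2 j k x| + 1.
have bnd (g : 'rV[R]_n.+1 -> 'M[R]_(p.+1, q.+1)) : {for x, continuous g} -> `|g x| <= K0 - 1 ->
    \forall z \near x, `|g z| <= K0.
  move=> gc gK; near=> z.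
  have : `|g x - g z| < 1 by near: z; exact: (@cvgr_dist_lt _ _ _ (nbhs x) _ g (g x) gc).
  move=> h; rewrite -[g z](subKr (g x)) (le_trans (ler_normB _ _))//.
  by rewrite -[K0](subrK 1) lerD// ltW.
have s1 : 0 <= \sum_j `|D1 j x| by apply: sumr_ge0.
have s2 : 0 <= \sum_j \sum_k `|D2 j k x| by apply: sumr_ge0 => j _; apply: sumr_ge0.
have le1 j : `|D1 j x| <= \sum_j `|D1 j x|.
  by rewrite [leRHS](bigD1 j)//= lerDl sumr_ge0.
have le2 j k : `|D2 j k x| <= \sum_j \sum_k `|D2 j k x|.
  apply: (@le_trans _ _ (\sum_k0 `|D2 j k0 x|)).
    by rewrite [leRHS](bigD1 k)//= lerDl sumr_ge0.
  rewrite [leRHS](bigD1 j)// lerDl; apply: sumr_ge0 => i _.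
  exact: sumr_ge0.
have fx0 : 0 <= `|f x| by [].
have : \forall z \near x, [/\ M z, `|f z| <= K0, forall j, `|D1 j z| <= K0 &
    forall jk, `|D2 jk.1 jk.2 z| <= K0].
  near=> z; split.
  - by near: z; exact: open_nbhs_nbhs.
  - by near: z; apply: bnd => //; rewrite /K0; lra.
  - near: z; apply: filter_forall => j; apply: bnd; first exact: fc1.
    by have := le1 j; rewrite /K0; lra.
  - near: z; apply: filter_forall => -[j k]/=; apply: bnd; first exact: fc2.
    by have := le2 j k; rewrite /K0; lra.
move=> /nbhs_ballP[r /= r0 rP].
have {}rP z : `|z - x| <= r / 2 -> [/\ M z, `|f z| <= K0, forall j, `|D1 j z| <= K0 &
    forall jk, `|D2 jk.1 jk.2 z| <= K0].
  by move=> zr; apply: rP; rewrite -ball_normE/= distrC; lra.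
have K00 : 0 < K0 by rewrite /K0; lra.
have n1 : 1 <= n.+1%:R :> R by rewrite ler1n.
pose N : R := n.+1%:R.
have NN : N <= N ^+ 2 by rewrite -/N in n1; nra.
have N1 : 1 <= N ^+ 2 by apply: le_trans NN.
have rd z : `|z - x| <= r / 2 -> differentiable f z by move=> /rP[Mz _ _ _]; exact: fd.
(* Halving the radius fits the closed ball into the neighbourhood; [N ^+ 2 * K0] dominates the
   constants [K0], [N * K0] and [N ^+ 2 * K0] of the separate bounds. *)
exists (r / 2), (N ^+ 2 * K0); split.
- by rewrite divr_gt0.
- by rewrite mulr_gt0// exprn_gt0// ltr0n.
- by move=> z /rP[].
- by move=> z /rP[_ h _ _]; apply: le_trans h _; rewrite ler_peMl// ltW.
split.
- move=> z v zr; rewrite derive_dirsum; last exact: rd.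
  apply: le_trans (norm_dirsum_le _ _) _; first by move=> j; have [_ _ h _] := rP z zr; exact: h.
  by rewrite ler_wpM2r// ler_wpM2r// ltW.
- move=> z z' zr z'r; apply: (le_trans (lipschitz_ball rd _ zr z'r (K := K0))).
    by move=> y j /rP[_ _ h _]; exact: h.
  by rewrite ler_wpM2r// ler_wpM2r// ltW.
- move=> z z' zr z'r; apply: (taylor_ball rd _ _ zr z'r).
    by move=> y j /rP[My _ _ _]; exact: fd1.
  by move=> y j k /rP[_ _ _ h]; exact: (h (j, k)).
Unshelve. all: by end_near. Qed.

(** * Integral surfaces of commuting fields *)

Lemma quadratic_is_diff (R : realType) (V W : normedModType R) (f : V -> W)
    (L : {linear V -> W}) (x : V) (C r : R) : continuous L -> 0 < r ->
  (forall v, `|v| < r -> `|f (x + v) - f x - L v| <= C * `|v| ^+ 2) ->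
  is_diff x f L.
Proof.
move=> Lc r0 fC.
(* The sign of [C] is arbitrary; this is a positive majorant by which one can divide. *)
have C1 : 0 < `|C| + 1 by rewrite ltr_wpDl.
have H : f \o shift x = cst (f x) + L +o_ 0 id.
  apply/eqaddoP => eps eps0; near=> v => /=.
  rewrite !fctE /= [v + x]addrC opprD addrA.
  have vr : `|v| < r by near: v; apply: (@nbhs0_lt _ _ r).
  have ve : `|v| < eps / (`|C| + 1) by near: v; apply: nbhs0_lt; rewrite divr_gt0.
  apply: le_trans (fC v vr) _; rewrite expr2 mulrA ler_wpM2r//.
  apply: le_trans (_ : (`|C| + 1) * `|v| <= _).
    by rewrite ler_wpM2r// (le_trans (ler_norm _))// lerDl.
  by rewrite mulrC -ler_pdivlMr// ltW.
have LE := diff_unique Lc H.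
by apply: DiffDef => //; apply/diff_locallyP; rewrite LE.
Unshelve. all: by end_near. Qed.

Lemma lipschitz_linear_continuous (R : realType) (V W : normedModType R)
    (L : {linear V -> W}) (C : R) :
  (forall v, `|L v| <= C * `|v|) -> continuous L.
Proof.
move=> LC v; apply/(@cvgrPdist_lt _ _ _ (nbhs v)) => eps eps0.
have c0 : 0 < `|C| + 1 by rewrite ltr_wpDl.
near=> z; rewrite -linearB.
have : `|v - z| < eps / (`|C| + 1).
  by near: z; apply: (@cvgr_dist_lt _ _ _ (nbhs v) _ id v); [exact: cvg_id|rewrite divr_gt0].
rewrite ltr_pdivlMr// => h; apply: le_lt_trans (LC _) (le_lt_trans _ h).
by rewrite mulrC ler_wpM2l// (le_trans (ler_norm _))// lerDl.
Unshelve. all: by end_near. Qed.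

Lemma mulmxr_continuous (R : realType) m n p (A : 'M[R]_(n.+1, p.+1)) :
  continuous (mulmxr A : 'M[R]_(m.+1, n.+1) -> 'M[R]_(m.+1, p.+1)).
Proof.
apply: (@lipschitz_linear_continuous _ _ _ _ (n.+1%:R * `|A|)) => v /=.
by apply: le_trans (mulmx_norm_le _ _) _; rewrite mulrAC.
Qed.

Lemma mulmx_continuous (R : realType) m n p (A : 'M[R]_(m.+1, n.+1)) :
  continuous (mulmx A : 'M[R]_(n.+1, p.+1) -> 'M[R]_(m.+1, p.+1)).
Proof.
apply: (@lipschitz_linear_continuous _ _ _ _ (n.+1%:R * `|A|)) => v /=.
exact: mulmx_norm_le.
Qed.

Lemma is_derive_linear (R : realType) (U V W : normedModType R)
    (L : {linear V -> W}) (f : U -> V) (x v : U) (df : V) :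
  continuous L -> is_derive x v f df -> is_derive x v (fun z => L (f z)) (L df).
Proof.
move=> Lc [fd <-].
have h : (fun h => h^-1 *: (L (f (h *: v + x)) - L (f x))) @ 0^' --> L ('D_v f x).
  under eq_fun do rewrite -linearB -linearZ/=.
  apply: (@continuous_cvg _ _ _ (0^') _ (fun h : R => h^-1 *: (f (h *: v + x) - f x)) L).
    exact: Lc.
  exact: fd.
by split; [apply/cvg_ex; exists (L ('D_v f x))|exact: cvg_lim].
Qed.

Lemma is_derive_scale_id (R : realType) m n (f : R -> 'M[R]_(m.+1, n.+1)) (t : R) df :
  is_derive t 1 f df -> is_derive t 1 (fun t => t *: f t) (f t + t *: df).
Proof.
move=> /is_derive_mxP fd; apply/is_derive_mxP => i j; rewrite !mxE.
under eq_fun do rewrite mxE.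
have := @is_deriveM _ _ id (fun t => f t i j) t 1 _ _ (is_derive_id _ _) (fd i j).
by rewrite /= [_ *: 1]mulr1 addrC.
Qed.

(** The last hypothesis is the vanishing of the brackets of the fields [u *m X] and [v *m X] for
    constant [u] and [v]. The surface sends [u] to the time-one point of the integral curve of
    [u *m X] through [x]. *)
Lemma commuting_fields_surface (R : realType) m n (M : set 'rV[R]_n.+1)
    (X : 'rV[R]_n.+1 -> 'M[R]_(m.+1, n.+1)) x :
  open M -> M x -> Ck 2 M X ->
  (forall z u v, M z -> u *m 'D_(v *m X z) X z = v *m 'D_(u *m X z) X z) ->
  exists (r : R) (s : 'rV[R]_m.+1 -> 'rV[R]_n.+1),
    [/\ 0 < r, s 0 = x & forall u, `|u| < r ->
         M (s u) /\ is_diff u s (fun v : 'rV[R]_m.+1 => v *m X (s u))].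
Proof.
move=> oM Mx X2 Xcomm.
have Xd z : M z -> differentiable X z by case: X2 => + _; exact.
have [rho [K [rho0 K0 rM XK [DK XL XT]]]] := Ck2_estimates oM Mx X2.
pose c := m.+1%:R * K; have c0 : 0 < c by rewrite mulr_gt0// ltr0n.
have mul_le p (u : 'rV[R]_m.+1) (A : 'M[R]_(m.+1, p.+1)) d : `|A| <= K * d ->
    `|u *m A| <= c * `|u| * d.
  move=> Ad; apply: le_trans (mulmx_norm_le _ _) _.
  rewrite /c -!mulrA ler_wpM2l// ![K * _]mulrCA ler_wpM2l//.
(* For [u] of norm below [r], [c * |u|] is at most 1/2, which makes the field Lipschitz with
   constant 1/2, and at most [rho], which confines its integral curve to the ball where the
   estimates hold. *)
pose r := Num.min 2^-1 rho / c.
have rr0 : 0 < r by rewrite divr_gt0// lt_min invr_gt0 ltr0n.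
have rc (u : 'rV[R]_m.+1) : `|u| < r -> c * `|u| <= 2^-1 /\ c * `|u| <= rho.
  rewrite ltr_pdivlMr// lt_min mulrC => /andP[? ?]; split; exact: ltW.
have /choice[g gP] : forall u : 'rV[R]_m.+1, exists g : R -> 'rV[R]_n.+1, `|u| < r ->
    [/\ g 0 = x, continuous g, forall t, `|g t - x| <= rho &
        forall t : R, 0 < t < 1 -> is_derive t 1 g (u *m X (g t))].
  move=> u.
  have [ur|] := boolP (`|u| < r); last by exists (fun=> 0).
  have [cu1 cu2] := rc u ur.
  have [||| g gP] := @ode_solution R n (fun z => u *m X z) x rho; last by exists g.
  - move=> z z' zr z'r; rewrite -mulmxBr.
    apply: le_trans (mul_le _ _ _ _ (XL z' z z'r zr)) _.
    by rewrite [leRHS]mulrC ler_wpM2r.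
  - move=> z zr; apply: le_trans (mul_le _ u (X z) 1 _) _; last by rewrite mulr1.
    by rewrite mulr1 XK.
  - exact: ltW.
pose s u := g u 1; exists r, s; split=> //.
  have n0 : `|0 : 'rV[R]_m.+1| < r by rewrite normr0.
  (* For [u = 0] the velocity is zero, and the mean value estimate with constant 0 shows that the
     curve stays at [x]. *)
  have [g0 gc gr gD] := gP 0 n0.
  have := @mean_value_le R 0 n (g 0) (fun t => (0 : 'rV[R]_m.+1) *m X (g 0 t)) 0 1 0 ler01.
  rewrite mul0r g0 normr_le0 subr_eq0 => /(_ _ _ _)/eqP; apply => //.
    by move=> t _; exact: gc.
  by move=> t _; rewrite mul0mx normr0.
move=> u ur; have [g0 gc gr gD] := gP u ur; split; first exact/rM/gr.
have [cu1 cu2] := rc u ur.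
pose L := mulmxr (X (s u)) : {linear 'rV[R]_m.+1 -> 'rV[R]_n.+1}.
apply: (@quadratic_is_diff _ _ _ s L u (8 * c ^+ 2) (r - `|u|)).
- exact: mulmxr_continuous.
- by rewrite subr_gt0.
move=> v vr; have uvr : `|u + v| < r by apply: le_lt_trans (ler_normD _ _) _; lra.
have [h0 hc hr hD] := gP (u + v) uvr; have [cv1 cv2] := rc _ uvr.
(* The splitting [w] of the difference of velocities is bounded by half the separation of the curves
   plus [c * |v|]. *)
have dist_le t : 0 <= t <= 1 -> `|g (u + v) t - g u t| <= 2 * (c * `|v|).
  pose w t := (u + v) *m (X (g (u + v) t) - X (g u t)) + v *m X (g u t).
  apply: (@small_growth _ _ _ (fun t => g (u + v) t - g u t) w).
  - by rewrite mulr_ge0// ltW.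
  - by rewrite h0 g0 subrr.
  - by move=> ? _; apply: continuousB; [exact: hc|exact: gc].
  - move=> {}t t01; have -> : w t = (u + v) *m X (g (u + v) t) - u *m X (g u t).
      by rewrite /w mulmxBr [X in _ - X + _]mulmxDl opprD addrA addrNK.
    by apply: is_deriveB; [exact: hD|exact: gD].
  - move=> {}t t01; apply: le_trans (ler_normD _ _) _; apply: lerD.
      apply: le_trans (mul_le _ _ _ _ (XL _ _ (gr t) (hr t))) _.
      by rewrite [leRHS]mulrC ler_wpM2r.
    have := mul_le _ v (X (g u t)) 1; rewrite !mulr1; apply; exact: XK.
pose dl t := g (u + v) t - g u t - t *: (v *m X (g u t)).
(* The derivative of [dl], regrouped into a Taylor remainder, a term linear in [dl] and a
   first-order difference. The regrouping rests on commutation, which lets [v *m 'D_(u *m X) X] be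
   replaced by [u *m 'D_(v *m X) X]. *)
pose ddl t := u *m (X (g (u + v) t) - X (g u t) - 'D_(g (u + v) t - g u t) X (g u t))
              + u *m 'D_(dl t) X (g u t) + v *m (X (g (u + v) t) - X (g u t)).
have Dlin z a b : M z -> 'D_(a - b) X z = 'D_a X z - 'D_b X z.
  by move=> /Xd zd; rewrite !deriveE// linearB.
have DlinZ z a b : M z -> 'D_(a *: b) X z = a *: 'D_b X z.
  by move=> /Xd zd; rewrite !deriveE// linearZ.
have Xg (t : R) : 0 < t < 1 ->
    is_derive t 1 (fun t => X (g u t)) ('D_(u *m X (g u t)) X (g u t)).
  by move=> t01; apply: is_derive_comp_curve; [exact: gD|exact/Xd/rM/gr].
have dlD (t : R) : 0 < t < 1 -> is_derive t 1 dl (ddl t).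
  move=> t01; have Mt := rM _ (gr t).
  have -> : ddl t = (u + v) *m X (g (u + v) t) - u *m X (g u t)
      - (v *m X (g u t) + t *: (v *m 'D_(u *m X (g u t)) X (g u t))).
    rewrite /ddl /dl (Dlin _ (g (u + v) t - g u t))// DlinZ//.
    rewrite -(Xcomm _ u v Mt) !mulmxBr mulmxDl -scalemxAr.
    move: ('D_(v *m _) X _) => D; move: (u *m X (g (u + v) t)) (u *m X _) (u *m D) => a b e.
    move: (u *m _) (v *m X (g (u + v) t)) (v *m _) => a' b' e'.
    by apply/rowP => j; rewrite !mxE; ring.
  apply: is_deriveB; first by apply: is_deriveB; [exact: hD|exact: gD].
  apply: is_derive_scale_id.
  by apply: (is_derive_linear (L := mulmx v)); [exact: mulmx_continuous|exact: Xg].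
have := @small_growth _ _ _ dl ddl (4 * c ^+ 2 * `|v| ^+ 2) _ _ _ dlD.
have -> : 8 * c ^+ 2 * `|v| ^+ 2 = 2 * (4 * c ^+ 2 * `|v| ^+ 2) by ring.
have -> : s (u + v) - s u - L v = dl 1 by rewrite /dl scale1r.
apply; last by rewrite ler01 lexx.
- by rewrite mulr_ge0 ?sqr_ge0// mulr_ge0 ?sqr_ge0 ?ler0n.
- by rewrite /dl h0 g0 subrr scale0r subrr.
- move=> t _; apply: continuousB; first by apply: continuousB; [exact: hc|exact: gc].
  have Xc : {for t, continuous (fun t => X (g u t))}.
    apply: (@continuous_comp _ _ _ (g u) X); first exact: gc.
    exact/differentiable_continuous/Xd/rM.
  apply: cvgZ; first exact: cvg_id.
  exact: (continuous_cvg _ (@mulmx_continuous _ _ _ _ v _) Xc).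
move=> t /andP[t0 t1]; have d : `|g (u + v) t - g u t| <= 2 * (c * `|v|).
  by apply: dist_le; rewrite !ltW.
have hA := mul_le _ u _ _ (XT _ _ (gr t) (hr t)).
have hB := mul_le _ u _ _ (DK _ (dl t) (gr t)).
have hC := mul_le _ v _ _ (XL _ _ (gr t) (hr t)).
have N0 : 0 <= `|g (u + v) t - g u t| by [].
have cv0 : 0 <= c * `|v| by rewrite mulr_ge0// ltW.
have sq : `|g (u + v) t - g u t| ^+ 2 <= 4 * (c * `|v|) ^+ 2.
  have -> : 4 * (c * `|v|) ^+ 2 = (2 * (c * `|v|)) ^+ 2 by ring.
  by rewrite !expr2; apply: ler_pM.
(* The Taylor remainder and the first-order difference contribute [2 * (c * |v|) ^+ 2] each, the
   linear term half the norm of [dl]. The resulting constant 4 is doubled by [small_growth], whence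
   the 8 above. *)
have hA' := ler_pM (mulr_ge0 (ltW c0) (normr_ge0 u)) (sqr_ge0 _) cu1 sq.
have hB' := ler_wpM2r (normr_ge0 (dl t)) cu1.
have hC' := ler_wpM2l cv0 d.
apply: le_trans (ler_normD _ _) _; apply: le_trans (lerD (ler_normD _ _) (lexx _)) _.
apply: le_trans (lerD (lerD hA hB) hC) _.
apply: le_trans (lerD (lerD hA' hB') hC') _.
by rewrite le_eqVlt; apply/orP; left; apply/eqP; field.
Qed.

(** * Calculus of maps of class C^k *)

Section Ck_calculus.
Context {R : realType} {n : nat}.
Implicit Types (A : set 'rV[R]_n.+1) (k : nat).

Lemma Ck_sub {W : normedModType R} k A B (f : 'rV[R]_n.+1 -> W) :
  B `<=` A -> Ck k A f -> Ck k B f.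
Proof.
move=> BA; elim: k f => [|k IH] f /=; first by move=> fc x /BA/fc.
by move=> [fd fk]; split=> [x /BA/fd//|i]; exact: IH.
Qed.

Lemma near_open {W : Type} A (f g : 'rV[R]_n.+1 -> W) x :
  open A -> (forall x, A x -> f x = g x) -> A x -> \near x, f x = g x.
Proof.
move=> oA fg Ax; have : \forall y \near x, A y by exact: open_nbhs_nbhs.
by apply: filterS => y; exact: fg.
Qed.

Lemma near_eq_differentiable {W : normedModType R} (f g : 'rV[R]_n.+1 -> W) x :
  (\near x, f x = g x) -> differentiable f x -> differentiable g x.
Proof.
move=> fg /diff_locallyP[dc dE]; have fgx : f x = g x by exact: nbhs_singleton fg.
have H : g \o shift x = cst (g x) + 'd f x +o_ 0 id.
  apply/eqaddoP => eps eps0.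
  move/eqaddoP: dE => /(_ eps eps0) dE; move: fg; rewrite (near_shift 0 x) subr0 => fg.
  near=> y; rewrite !fctE /=.
  have <- : f (y + x) = g (y + x) by near: y.
  by rewrite -fgx; near: y.
have gE := diff_unique dc H.
by apply/diff_locallyP; rewrite gE.
Unshelve. all: by end_near. Qed.

(** On an open set equality of maps is equality of germs, so it passes to all derivatives. Formulas
    for partial derivatives that hold only on [A] thereby become usable in inductions on [k]. *)
Lemma Ck_eq {W : normedModType R} k A (f g : 'rV[R]_n.+1 -> W) :
  open A -> (forall x, A x -> f x = g x) -> Ck k A f -> Ck k A g.
Proof.
move=> oA; elim: k f g => [|k IH] f g fg /=.
  move=> fc x Ax; have e := near_open oA fg Ax.
  have fcx : f @ x --> f x := fc x Ax; rewrite (fg _ Ax) in fcx.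
  exact: cvg_trans (@near_eq_cvg _ _ (nbhs x) _ f g e) fcx.
move=> [fd fk]; split=> [x Ax|i].
  exact: near_eq_differentiable (near_open oA fg Ax) (fd x Ax).
apply: IH (fk i) => x Ax; exact: near_eq_derive (near_open oA fg Ax).
Qed.

Lemma CkS {W : normedModType R} k A (f : 'rV[R]_n.+1 -> W) : Ck k.+1 A f -> Ck k A f.
Proof.
elim: k f => [|k IH] f.
  by move=> [fd _] x /fd/differentiable_continuous.
by move=> [fd fk]; split=> // i; exact: IH.
Qed.

Lemma Ck_cst {W : normedModType R} k A (a : W) : Ck k A (cst a).
Proof.
elim: k a => [|k IH] a /=; first by move=> x _; exact: cst_continuous.
split=> [x _|i]; first exact: differentiable_cst.
rewrite (_ : (fun x => _) = cst 0); first exact: IH.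
by rewrite funeqE => x; rewrite derive_cst.
Qed.

Lemma CkD {W : normedModType R} k A (f g : 'rV[R]_n.+1 -> W) :
  open A -> Ck k A f -> Ck k A g -> Ck k A (fun x => f x + g x).
Proof.
move=> oA; elim: k f g => [|k IH] f g /=.
  by move=> fc gc x Ax; apply: continuousD; [exact: fc|exact: gc].
move=> [fd fk] [gd gk]; split=> [x Ax|i].
  by apply: differentiableD; [exact: fd|exact: gd].
apply: Ck_eq (IH _ _ (fk i) (gk i)) => // x Ax.
by rewrite -deriveD//; apply: diff_derivable; [exact: fd|exact: gd].
Qed.

Lemma Ck_sum {W : normedModType R} k A (I : Type) (r : seq I) (P : pred I)
    (f : I -> 'rV[R]_n.+1 -> W) :
  open A -> (forall i, P i -> Ck k A (f i)) -> Ck k A (fun x => \sum_(i <- r | P i) f i x).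
Proof.
move=> oA fk; elim: r => [|i r IH].
  rewrite (_ : (fun x => _) = cst 0); first exact: Ck_cst.
  by rewrite funeqE => x; rewrite big_nil.
case: (boolP (P i)) => Pi; last by under eq_fun do rewrite big_cons (negbTE Pi).
under eq_fun do rewrite big_cons Pi.
by apply: CkD => //; exact: fk.
Qed.

Lemma CkM k A (f g : 'rV[R]_n.+1 -> R) :
  open A -> Ck k A f -> Ck k A g -> Ck k A (fun x => f x * g x).
Proof.
move=> oA; elim: k f g => [|k IH] f g.
  by move=> fc gc x Ax; apply: continuousM; [exact: fc|exact: gc].
move=> fS gS; have [[fd fk] [gd gk]] := (fS, gS); split=> [x Ax|i].
  by apply: differentiableM; [exact: fd|exact: gd].
apply: (@Ck_eq _ _ _ (fun x => f x * 'D_(delta_mx 0 i) g x + g x * 'D_(delta_mx 0 i) f x)) => //.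
  move=> x Ax; symmetry.
  by apply: (@deriveM _ _ f g); apply: diff_derivable; [exact: fd|exact: gd].
have [f0 g0] := (CkS fS, CkS gS).
by apply: CkD => //; apply: IH; [exact: f0|exact: gk|exact: g0|exact: fk].
Qed.

Lemma Ck_prod k A (I : Type) (r : seq I) (P : pred I) (f : I -> 'rV[R]_n.+1 -> R) :
  open A -> (forall i, P i -> Ck k A (f i)) -> Ck k A (fun x => \prod_(i <- r | P i) f i x).
Proof.
move=> oA fk; elim: r => [|i r IH].
  rewrite (_ : (fun x => _) = cst 1); first exact: Ck_cst.
  by rewrite funeqE => x; rewrite big_nil.
case: (boolP (P i)) => Pi; last by under eq_fun do rewrite big_cons (negbTE Pi).
under eq_fun do rewrite big_cons Pi.
by apply: CkM => //; exact: fk.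
Qed.

Lemma CkV k A (f : 'rV[R]_n.+1 -> R) :
  open A -> (forall x, A x -> f x != 0) -> Ck k A f -> Ck k A (fun x => (f x)^-1).
Proof.
move=> oA f0; elim: k => [|k IH].
  by move=> fc x Ax; apply: continuousV; [exact: f0|exact: fc].
move=> fS; have [fd fk] := fS; split=> [x Ax|i].
  by apply: differentiableV; [exact: fd|exact: f0].
(* With the inverse square written as a product of two inverses, the induction hypothesis and [CkM]
   apply. *)
apply: (@Ck_eq _ _ _ (fun x => -1 * ((f x)^-1 * (f x)^-1) * 'D_(delta_mx 0 i) f x)) => //.
  move=> x Ax; rewrite (@deriveV _ _ f); [|exact: f0|exact/diff_derivable/fd].
  by rewrite mulN1r -invfM.
have Vk : Ck k A (fun x => (f x)^-1) by exact/IH/CkS.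
apply: CkM => //; last exact: fk.
by apply: CkM => //; [exact: Ck_cst|exact: CkM].
Qed.

Lemma CkZ {W : normedModType R} k A (f : 'rV[R]_n.+1 -> R) (w : W) :
  open A -> Ck k A f -> Ck k A (fun x => f x *: w).
Proof.
move=> oA; elim: k f => [|k IH] f /=.
  by move=> fc x Ax; apply: continuousZr_tmp; exact: (fc x Ax).
move=> [fd fk]; split=> [x Ax|i]; first by apply: differentiableZl; exact: fd.
apply: Ck_eq (IH _ (fk i)) => // x Ax.
rewrite [RHS]deriveE; last by apply: differentiableZl; exact: fd.
by rewrite diffZl ?deriveE//; exact: fd.
Qed.

Lemma Ck_mxP p q k A (f : 'rV[R]_n.+1 -> 'M[R]_(p.+1, q.+1)) :
  open A -> Ck k A f <-> forall i j, Ck k A (fun x => f x i j).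
Proof.
move=> oA; split=> [fk i j|fk].
  elim: k f fk => [|k IH] f /=.
    move=> fc x Ax; apply: (@continuous_comp _ _ _ f (fun M : 'M[R]_(p.+1, q.+1) => M i j)).
      exact: fc.
    exact: coord_continuous.
  move=> [fd fk]; split=> [x Ax|l].
    exact: (@differentiable_comp _ _ _ _ f (fun M : 'M[R]_(p.+1, q.+1) => M i j) _
      (fd _ Ax) (differentiable_coord _ _ _)).
  apply: Ck_eq (IH _ (fk l)) => // x Ax.
  by rewrite derive_mx ?mxE//; exact/diff_derivable/fd.
have -> : f = fun x => \sum_i \sum_j f x i j *: delta_mx i j.
  by apply/funext => x; rewrite -matrix_sum_delta.
by apply: Ck_sum => // i _; apply: Ck_sum => // j _; exact: CkZ.
Qed.

End Ck_calculus.

Lemma Ck_comp (R : realType) m n p q k (A : set 'rV[R]_m.+1) (B : set 'rV[R]_n.+1)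
    (f : 'rV[R]_n.+1 -> 'M[R]_(p.+1, q.+1)) (s : 'rV[R]_m.+1 -> 'rV[R]_n.+1) :
  open A -> open B -> (forall x, A x -> B (s x)) ->
  Ck k B f -> Ck k A s -> Ck k A (fun x => f (s x)).
Proof.
move=> oA oB AB fk sk; apply/Ck_mxP => // i j; move/(Ck_mxP _ _ oB)/(_ i j): fk.
(* For scalar [h] the chain rule involves only the scalar partial derivatives of [h] and the entries
   of those of [s], so the induction stays within scalar functions. *)
suff H (h : 'rV[R]_n.+1 -> R) : Ck k B h -> Ck k A (fun x => h (s x)).
  exact: (H (fun x => f x i j)).
elim: k h sk {f i j} => [|k IH] f sk.
  by move=> fc x Ax; apply: continuous_comp; [exact: sk|apply: fc; exact: AB].
move=> [fd fk]; have [sd sk'] := sk; split=> [x Ax|i].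
  by apply: differentiable_comp; [exact: sd|apply: fd; exact: AB].
apply: (@Ck_eq _ _ _ _ _
  (fun x => \sum_l 'D_(delta_mx 0 i) s x 0 l * 'D_(delta_mx 0 l) f (s x))) => //.
  move=> x Ax; have fx := fd _ (AB _ Ax).
  have fsx : differentiable (f \o s) x by apply: differentiable_comp => //; exact: sd.
  rewrite -[RHS]/('D_(delta_mx 0 i) (f \o s) x) (deriveE _ fsx) diff_comp//=; last exact: sd.
  by rewrite -(deriveE _ (sd _ Ax)) -(deriveE _ fx) [RHS]derive_dirsum.
apply: Ck_sum => // l _; apply: CkM => //.
  by have /(Ck_mxP _ _ oA) := sk' i; exact.
by apply: (IH ('D_(delta_mx 0 l) f)); [exact: CkS|exact: fk].
Qed.

Section Ck_matrix.
Context {R : realType} {n : nat}.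
Implicit Types (A : set 'rV[R]_n.+1) (k : nat).

Lemma Ck_mulmx p q r k A (f : 'rV[R]_n.+1 -> 'M[R]_(p.+1, q.+1))
    (g : 'rV[R]_n.+1 -> 'M[R]_(q.+1, r.+1)) :
  open A -> Ck k A f -> Ck k A g -> Ck k A (fun x => f x *m g x).
Proof.
move=> oA fk gk; apply/Ck_mxP => // i j; under eq_fun do rewrite mxE.
apply: Ck_sum => // l _; apply: CkM => //; first by move/(Ck_mxP _ _ oA): fk; exact.
by move/(Ck_mxP _ _ oA): gk; exact.
Qed.

Lemma Ck_det p k A (f : 'rV[R]_n.+1 -> 'M[R]_p) :
  open A -> (forall i j, Ck k A (fun x => f x i j)) -> Ck k A (fun x => \det (f x)).
Proof.
move=> oA fk; rewrite /determinant; apply: Ck_sum => // s _.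
by apply: CkM => //; [exact: Ck_cst|exact: Ck_prod].
Qed.

(** By Cramer's formula the entries are cofactors divided by the determinant. *)
Lemma Ck_invmx p k A (f : 'rV[R]_n.+1 -> 'M[R]_p.+1) :
  open A -> (forall x, A x -> f x \in unitmx) -> Ck k A f ->
  Ck k A (fun x => invmx (f x)).
Proof.
move=> oA fu /(Ck_mxP _ _ oA) fk.
apply: (@Ck_eq _ _ _ _ _ (fun x => (\det (f x))^-1 *: \adj (f x))) => //.
  by move=> x Ax; rewrite /invmx fu.
apply/Ck_mxP => // i j; under eq_fun do rewrite !mxE.
apply: CkM => //.
  apply: CkV => //; last exact: Ck_det.
  by move=> x /fu; rewrite unitmxE unitfE.
rewrite /cofactor; apply: CkM => //; first exact: Ck_cst.
by apply: Ck_det => // a b; under eq_fun do rewrite !mxE; exact: fk.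
Qed.

End Ck_matrix.

(** * Frobenius' theorem for involutive row spaces *)

Lemma is_derive_mulmx (R : realType) (V : normedModType R) m n p
    (f : V -> 'M[R]_(m.+1, n.+1)) (g : V -> 'M[R]_(n.+1, p.+1)) (x v : V) df dg :
  is_derive x v f df -> is_derive x v g dg ->
  is_derive x v (fun z => f z *m g z) (df *m g x + f x *m dg).
Proof.
move=> /is_derive_mxP fd /is_derive_mxP gd; apply/is_derive_mxP => i j.
rewrite !mxE -big_split/=; under eq_fun do rewrite mxE.
have := @is_derive_sum _ _ _ _ (fun k z => f z i k * g z k j) x v
  (fun k => df i k * g x k j + f x i k * dg k j).
rewrite fct_sumE; apply => k.
have := @is_deriveM _ _ (fun z => f z i k) (fun z => g z k j) x v _ _ (fd i k) (gd k j).
by rewrite addrC [_ *: df _ _]mulrC.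
Qed.

Lemma smooth_is_derive (R : realType) n (W : normedModType R) (A : set 'rV[R]_n.+1)
    (f : 'rV[R]_n.+1 -> W) x v : smooth A f -> A x -> is_derive x v f ('D_v f x).
Proof. by move=> /(_ 1%N)[fd _] /fd fx; split=> //; exact: diff_derivable. Qed.

(** The involutivity hypothesis concerns the brackets of constant combinations of the rows of [Y].
    Normalizing the frame makes these brackets vanish, which reduces the claim to commuting
    fields. *)
Lemma involutive_surface (R : realType) m n (M : set 'rV[R]_n.+1)
    (Y : 'rV[R]_n.+1 -> 'M[R]_(m.+1, n.+1)) x :
  open M -> smooth M Y -> (forall z, M z -> row_free (Y z)) ->
  (forall z u v, M z ->
     (u *m 'D_(v *m Y z) Y z - v *m 'D_(u *m Y z) Y z <= Y z)%MS) ->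
  M x ->
  exists (N : set 'rV[R]_m.+1) (s : 'rV[R]_m.+1 -> 'rV[R]_n.+1),
    [/\ open N, N 0, smooth N s, s 0 = x & forall h, N h ->
       [/\ M (s h), \rank ('J s h) = m.+1 &
           [set v | (v <= Y (s h))%MS] = range ('d s h)]].
Proof.
move=> oM Ys Yf Yinv Mx.
have [L YL] := row_freeP (Yf x Mx).
pose G z := Y z *m L.
(* [G] is the identity at [x], hence invertible nearby; taking the interior makes [U] open by
   construction. *)
pose U := [set z | M z /\ G z \in unitmx]°.
have oU : open U by exact: open_interior.
have UM z : U z -> M z /\ G z \in unitmx by move=> /interior_subset.
have Gk k : Ck k M G by apply: Ck_mulmx => //; exact: Ck_cst.
have Ux : U x.
  have dc : {for x, continuous (fun z => \det (G z))}.
    by apply: (@Ck_det _ _ _ 0%N M G) => // i j; have /(Ck_mxP _ _ oM) := Gk 0%N; exact.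
  have d0 : \det (G x) != 0 by rewrite /G YL det1 oner_neq0.
  have Gn0 : \forall z \near x, \det (G z) != 0.
    exact: (@cvgr_neq0 _ _ _ (nbhs x) _ (fun z => \det (G z)) (\det (G x)) dc d0).
  have Mn : \forall z \near x, M z by exact: open_nbhs_nbhs.
  rewrite /U /interior /=; near=> z; split; first by near: z.
  by rewrite unitmxE unitfE; near: z.
pose X z := invmx (G z) *m Y z.
have iGk k : Ck k U (fun z => invmx (G z)).
  by apply: Ck_invmx => // [z /UM[]//|]; apply: Ck_sub (Gk k) => z /UM[].
have Yk k : Ck k U Y by apply: Ck_sub (Ys k) => z /UM[].
have Xk k : Ck k U X by exact: Ck_mulmx.
have XL z : U z -> X z *m L = 1%:M by move=> /UM[_ Gu]; rewrite -mulmxA mulVmx.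
have DXL z w : U z -> 'D_w X z *m L = 0.
  move=> Uz; have h := is_derive_linear (@mulmxr_continuous _ _ _ _ L) (smooth_is_derive w Xk Uz).
  have h0 : is_derive z w (fun z => X z *m L) 0.
    apply: (@near_eq_is_derive _ _ _ (cst 1%:M)) => //.
    by apply: near_open oU _ Uz => y /XL ->.
  by rewrite -[LHS](@derive_val _ _ _ _ _ _ _ h) (@derive_val _ _ _ _ _ _ _ h0).
have Xcomm z u v : U z -> u *m 'D_(v *m X z) X z = v *m 'D_(u *m X z) X z.
  move=> Uz; have [Mz Gu] := UM z Uz.
  apply/eqP; rewrite -subr_eq0; apply/eqP; set p := LHS.
  have cXL (c : 'rV[R]_m.+1) d : c *m 'D_d X z *m L = 0.
    by rewrite -mulmxA (DXL z d Uz) mulmx0.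
  have pL : p *m L = 0.
    rewrite mulmxBl; apply/eqP; rewrite subr_eq0; apply/eqP.
    by rewrite [LHS]cXL [RHS]cXL.
  have DX w : 'D_w X z = 'D_w (fun z => invmx (G z)) z *m Y z + invmx (G z) *m 'D_w Y z.
    have h := is_derive_mulmx (smooth_is_derive w iGk Uz) (smooth_is_derive w Yk Uz).
    exact: (@derive_val _ _ _ _ _ _ _ h).
  (* The terms where [invmx (G z)] is differentiated lie in the row space of [Y z] trivially, the
     others by involutivity for the coefficients [u *m invmx (G z)] and [v *m invmx (G z)]. Since
     [L] is injective on this row space, [pL] then forces [p = 0]. *)
  have /submxP[c pE] : (p <= Y z)%MS.
    rewrite /p !DX !mulmxDr !mulmxA opprD addrACA addmx_sub//.
      by rewrite addmx_sub ?eqmx_opp ?submxMl.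
    by have := Yinv z (u *m invmx (G z)) (v *m invmx (G z)) Mz; rewrite -!(mulmxA _ _ (Y z)).
  move: pL; rewrite pE -mulmxA => /(congr1 (mulmx^~ (invmx (G z)))).
  by rewrite mulmxK// mul0mx => ->; rewrite mul0mx.
have [r [s [r0 s0 sP]]] := commuting_fields_surface oU Ux (Xk 2%N) Xcomm.
exists (ball 0 r), s.
have bP (h : 'rV[R]_m.+1) : ball 0 r h -> `|h| < r by rewrite -ball_normE/= sub0r normrN.
have oN : open (ball (0 : 'rV[R]_m.+1) r) by exact: ball_open.
have sd (h : 'rV[R]_m.+1) : ball 0 r h -> [/\ U (s h), differentiable s h &
    forall v, 'd s h v = v *m X (s h)].
  by move=> /bP/sP[Us [sd sE]]; split=> // v; rewrite sE.
split=> //.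
- exact: ballxx.
(* The partial derivatives of [s] are rows of [X] composed with [s], hence as smooth as [s] is
   already known to be; each round gains one order. *)
- elim=> [|k IH].
    by move=> h /sd[_ ? _]; exact: differentiable_continuous.
  split=> [h /sd[]//|i].
  apply: (@Ck_eq _ _ _ _ _ (fun h => delta_mx 0 i *m X (s h))) => //.
    by move=> h /sd[_ dh dE]; rewrite deriveE// dE.
  apply: Ck_mulmx => //; first exact: Ck_cst.
  by apply: (Ck_comp (B := U)) => // h /sd[].
move=> h /sd[Us dh dE]; have [Ms Gu] := UM _ Us; split=> //.
  have -> : 'J s h = X (s h).
    by apply/row_matrixP => i; rewrite !rowE mul_rV_lin1 dE.
  by apply/eqP/row_freeP; exists L; exact: XL.
apply/seteqP; split=> v /=.
  (* [Y] equals [G *m X] at the point, so coefficients [c] in the frame [Y] become [c *m G] in the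
     frame [X]. *)
  move=> /submxP[c ->]; exists (c *m G (s h)) => //.
  by rewrite dE /X mulmxA -[c *m _ *m _]mulmxA mulmxV// mulmx1.
by move=> [c _ <-]; rewrite dE /X mulmxA submxMl.
Unshelve. all: by end_near. Qed.

(** * Sums over two indices and evaluation of forms *)

Lemma sum_ord2 (V : zmodType) (F : 'I_2 -> V) : \sum_i F i = F 0 + F 1.
Proof. by rewrite big_ord_recl big_ord1; congr (_ + F _); exact: val_inj. Qed.

Lemma forall_ord2 (P : 'I_2 -> Prop) : P 0 -> P 1 -> forall i, P i.
Proof.
move=> P0 P1 [[|[|i]] //= lti].
  by rewrite (_ : Ordinal lti = 0)//; exact: val_inj.
by rewrite (_ : Ordinal lti = 1)//; exact: val_inj.
Qed.

Lemma fam0 : fam 0 = 0. Proof. exact: val_inj. Qed.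
Lemma fam1 : fam 1 = 1. Proof. exact: val_inj. Qed.

Lemma evD (R : realType) (w : form1 R) x u v : ev w x (u + v) = ev w x u + ev w x v.
Proof. by rewrite /ev mulmxDl mxE. Qed.

Lemma evZ (R : realType) (w : form1 R) x c v : ev w x (c *: v) = c * ev w x v.
Proof. by rewrite /ev -scalemxAl mxE. Qed.

Lemma ev_sum (R : realType) (w : form1 R) x (I : Type) (r : seq I) (F : I -> 'rV[R]_4) :
  ev w x (\sum_(i <- r) F i) = \sum_(i <- r) ev w x (F i).
Proof. by rewrite /ev mulmx_suml summxE. Qed.

Lemma is_derive_entry (R : realType) (V : normedModType R) m n
    (f : V -> 'M[R]_(m.+1, n.+1)) (x v : V) df i j :
  is_derive x v f df -> is_derive x v (fun z => f z i j) (df i j).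
Proof. by move=> /is_derive_mxP. Qed.

Lemma is_derive_ev (R : realType) (w : form1 R) (Y : 'rV[R]_4 -> 'rV[R]_4) x v dw dY :
  is_derive x v w dw -> is_derive x v Y dY ->
  is_derive x v (fun z => ev w z (Y z)) ((dY *m w x) 0 0 + (Y x *m dw) 0 0).
Proof.
move=> wd Yd; have := is_derive_entry 0 0 (is_derive_mulmx Yd wd).
by rewrite mxE.
Qed.

Lemma derive_ev_cst (R : realType) (w : form1 R) (u x v : 'rV[R]_4) dw :
  is_derive x v w dw -> 'D_v (fun z => ev w z u) x = (u *m dw) 0 0.
Proof.
move=> wd; have := is_derive_ev wd (is_derive_cst u x v).
by rewrite mul0mx mxE add0r => -[_ <-].
Qed.

(** * The dual frame and the frame of the transversal distribution *)

Section Frame.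
Context {R : realType} {M : set 'rV[R]_4} {w : 'I_3 -> 'I_2 -> form1 R}
  {e : 'I_2 -> 'I_2 -> 'rV[R]_4 -> 'rV[R]_4} {a : 'I_2 -> 'rV[R]_4 -> R}.
Context (he : dual_frame M w e) (ha : forall x, M x -> exists i, a i x != 0).

(** With the forms as columns of [W] and the frame vectors as rows of [E], duality reads
    [E *m W = 1]; for square matrices this gives [W *m E = 1], which is the expansion. *)
Lemma dual_frame_expansion x v : M x ->
  v = \sum_al \sum_i ev (w (fam al) i) x v *: e al i x.
Proof.
(* The four positions list the pairs of indices lexicographically: [al] is the quotient by 2, [ix]
   the parity. *)
move=> Mx; pose al (k : 'I_4) : 'I_2 := if (k < 2)%N then 0 else 1.
pose ix (k : 'I_4) : 'I_2 := if odd k then 1 else 0.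
pose W : 'M[R]_4 := \matrix_(l, k) w (fam (al k)) (ix k) x l 0.
pose E : 'M[R]_4 := \matrix_(k, l) e (al k) (ix k) x 0 l.
have evW (u : 'rV[R]_4) k : (u *m W) 0 k = ev (w (fam (al k)) (ix k)) x u.
  by rewrite /ev !mxE; apply: eq_bigr => l _; rewrite mxE.
have EW : E *m W = 1%:M.
  apply/matrixP => k l; have -> : (E *m W) k l = (e (al k) (ix k) x *m W) 0 l.
    by rewrite !mxE; apply: eq_bigr => j _; rewrite !mxE.
  rewrite evW he.2// mxE /al /ix.
  by case: k => [[|[|[|[|k]]]] ltk]; case: l => [[|[|[|[|l]]]] ltl].
have {1}-> : v = v *m W *m E by rewrite -mulmxA (mulmx1C EW) mulmx1.
have -> : v *m W *m E = \sum_k (v *m W) 0 k *: e (al k) (ix k) x.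
  rewrite mulmx_sum_row; apply: eq_bigr => k _; congr (_ *: _).
  by apply/rowP => l; rewrite !mxE.
by rewrite !sum_ord2 !big_ord_recl big_ord0 addr0 !evW addrA.
Qed.

Definition ker_vec (i : 'I_2) (z : 'rV[R]_4) : R := if i == 0 then a 1 z else - a 0 z.

Definition transversal_frame (z : 'rV[R]_4) : 'M[R]_(2, 4) :=
  \matrix_al \sum_i ker_vec i z *: e al i z.

Lemma ev_transversal_frame al i z (u : 'rV[R]_2) : M z ->
  ev (w (fam al) i) z (u *m transversal_frame z) = u 0 al * ker_vec i z.
Proof.
move=> Mz; rewrite mulmx_sum_row ev_sum !sum_ord2 !evZ !rowK.
rewrite !sum_ord2 !evD !evZ !he.2//.
by move: al i; apply: forall_ord2; apply: forall_ord2; rewrite /= ; ring.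
Qed.

(** The kernel of a nonzero covector in dimension two is a line; the factor [k] is found by dividing
    by whichever component of [a] is nonzero. *)
Lemma ker_vecP z (c : 'I_2 -> R) : M z -> \sum_i a i z * c i = 0 ->
  exists k, forall i, c i = k * ker_vec i z.
Proof.
move=> /ha[]; rewrite sum_ord2; apply: forall_ord2 => ai0 ac.
  exists (- (c 1 / a 0 z)); apply: forall_ord2; rewrite /ker_vec/=; last by field.
  apply: (mulfI ai0); have -> : a 0 z * c 0 = - (a 1 z * c 1) by lra.
  by field.
exists (c 0 / a 1 z); apply: forall_ord2; rewrite /ker_vec/=; first by field.
apply: (mulfI ai0); have -> : a 1 z * c 1 = - (a 0 z * c 0) by lra.
by field.
Qed.

Lemma transversal_distributionP z v : transversal_distribution w a z v <->
  forall al, \sum_i a i z * ev (w (fam al) i) z v = 0.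
Proof.
split=> [[h0 h1]|h]; first by apply: forall_ord2; rewrite ?fam0 ?fam1.
by split; [rewrite -fam0|rewrite -fam1]; exact: h.
Qed.

(** The same linear condition is imposed on both blocks of coordinates of [v]. By [ker_vecP] each
    block is a multiple of the kernel vector, with one free coefficient for each [al]. *)
Lemma transversal_distributionE z : M z ->
  transversal_distribution w a z = [set v | (v <= transversal_frame z)%MS].
Proof.
move=> Mz; apply/seteqP; split=> v /=.
  move=> /transversal_distributionP h.
  have /choice[k kP] : forall al, exists k, forall i, ev (w (fam al) i) z v = k * ker_vec i z.
    by move=> al; apply: ker_vecP.
  apply/submxP; exists (\row_al k al); rewrite [LHS](dual_frame_expansion v Mz).
  rewrite mulmx_sum_row; apply: eq_bigr => al _; rewrite mxE rowK scaler_sumr.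
  by apply: eq_bigr => i _; rewrite kP scalerA.
move=> /submxP[u ->]; apply/transversal_distributionP => al.
by rewrite sum_ord2 !ev_transversal_frame// /ker_vec/=; ring.
Qed.

Lemma transversal_frame_free z : M z -> row_free (transversal_frame z).
Proof.
move=> Mz; apply: inj_row_free => u u0; apply/rowP => al; rewrite mxE.
have h i : u 0 al * ker_vec i z = 0.
  by rewrite -ev_transversal_frame// u0 /ev mul0mx mxE.
have [i] := ha Mz; move: i; apply: forall_ord2 => ai.
  by have /eqP := h 1; rewrite /ker_vec/= mulf_eq0 oppr_eq0 (negbTE ai) orbF => /eqP.
by have /eqP := h 0; rewrite /ker_vec/= mulf_eq0 (negbTE ai) orbF => /eqP.
Qed.

Lemma transversal_frame_smooth : open M -> (forall i, smooth M (a i)) ->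
  smooth M transversal_frame.
Proof.
move=> oM sa k; apply/Ck_mxP => // al j.
have -> : (fun z => transversal_frame z al j) = fun z => \sum_i ker_vec i z * e al i z 0 j.
  by apply/funext => z; rewrite !mxE summxE; apply: eq_bigr => i _; rewrite mxE.
apply: Ck_sum => // i _; apply: CkM => //; last first.
  by have /(Ck_mxP _ _ oM) := he.1 al i k; exact.
move: i; apply: forall_ord2; rewrite /ker_vec/=; first exact: sa.
have -> : (fun z => - a 0 z) = fun z => -1 * a 0 z by apply/funext => z; rewrite mulN1r.
by apply: CkM => //; [exact: Ck_cst|exact: sa].
Qed.

End Frame.

(** * Involutivity and parallelism of the transversal distribution *)

(** The algebra behind involutivity: [n] is the kernel vector and [c] the covector. [A - B] stands
    for the exterior derivative of a coframe form on two vectors of the distribution with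
    coefficients [t] and [s], [o] and [o'] for the connection forms on them, [Da] and [Db] for
    derivatives of the covector. The connection terms from both sources cancel. *)
Lemma bracket_cancellation (R : comRingType) (n c A B Da Db : 'I_2 -> R)
    (o o' : 'I_2 -> 'I_2 -> R) (s t : R) :
  (forall i, A i - B i = \sum_j (t * n j * o j i - s * n j * o' j i)) ->
  \sum_i n i * Da i = \sum_i n i * \sum_j c j * o' i j ->
  \sum_i n i * Db i = \sum_i n i * \sum_j c j * o i j ->
  (- (\sum_i Da i * (s * n i)) - \sum_i c i * A i) -
  (- (\sum_i Db i * (t * n i)) - \sum_i c i * B i) = 0.
Proof.
move=> AB; have AE i : A i = B i + \sum_j (t * n j * o j i - s * n j * o' j i).
  by rewrite -AB addrC subrK.
rewrite !sum_ord2 !AE !sum_ord2 => ha hb.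
transitivity (t * (n 0 * Db 0 + n 1 * Db 1) - s * (n 0 * Da 0 + n 1 * Da 1)
  - (c 0 * (t * n 0 * o 0 0 - s * n 0 * o' 0 0 + (t * n 1 * o 1 0 - s * n 1 * o' 1 0))
   + c 1 * (t * n 0 * o 0 1 - s * n 0 * o' 0 1 + (t * n 1 * o 1 1 - s * n 1 * o' 1 1)))).
  by ring.
by rewrite ha hb; ring.
Qed.

Section Web.
Context {R : realType} {M : set 'rV[R]_4} {w : 'I_3 -> 'I_2 -> form1 R}
  {e : 'I_2 -> 'I_2 -> 'rV[R]_4 -> 'rV[R]_4} {om : 'I_2 -> 'I_2 -> form1 R}
  {a : 'I_2 -> 'rV[R]_4 -> R} {P Q : 'I_2 -> 'I_2 -> 'rV[R]_4 -> R}.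
Context (oM : open M) (sw : forall u i, smooth M (w u i)) (he : dual_frame M w e)
  (hstr : structure_equations M w om a) (hpf : pfaffian_derivatives M w om a P Q)
  (ha : forall x, M x -> exists i, a i x != 0).

Local Notation Y := (transversal_frame (e := e) (a := a)).
Local Notation nn := (ker_vec (a := a)).

Lemma derive_annihilated al (Z : 'rV[R]_4 -> 'rV[R]_4) x v dZ : M x ->
  is_derive x v Z dZ ->
  (forall z, M z -> \sum_i a i z * ev (w (fam al) i) z (Z z) = 0) ->
  \sum_i ('D_v (a i) x * ev (w (fam al) i) x (Z x) +
          a i x * 'D_v (fun z => ev (w (fam al) i) z (Z z)) x) = 0.
Proof.
move=> Mx Zd aZ; have [_ sa _ _] := hstr.
have wZ i : is_derive x v (fun z => ev (w (fam al) i) z (Z z))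
    ('D_v (fun z => ev (w (fam al) i) z (Z z)) x).
  have h := is_derive_ev (smooth_is_derive v (sw (fam al) i) Mx) Zd.
  by rewrite (@derive_val _ _ _ _ _ _ _ h).
have h0 : is_derive x v (fun z => \sum_i a i z * ev (w (fam al) i) z (Z z)) 0.
  by apply: (@near_eq_is_derive _ _ _ (cst 0)) => //; apply: near_open oM _ Mx => z /aZ ->.
have h1 : is_derive x v (fun z => \sum_i a i z * ev (w (fam al) i) z (Z z))
   (\sum_i ('D_v (a i) x * ev (w (fam al) i) x (Z x) +
          a i x * 'D_v (fun z => ev (w (fam al) i) z (Z z)) x)).
  rewrite -(fct_sumE _ _ (fun i z => a i z * ev (w (fam al) i) z (Z z))).
  apply: is_derive_sum => i.
  have := @is_deriveM _ _ (a i) _ x v _ _ (smooth_is_derive v (sa i) Mx) (wZ i).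
  by rewrite addrC [_ *: 'D_v (a i) x]mulrC.
by rewrite -(@derive_val _ _ _ _ _ _ _ h1) (@derive_val _ _ _ _ _ _ _ h0).
Qed.

(** Each torsion term has the factor [a_j omega_(al)^j], which vanishes on both vectors; the two
    structure equations, differing in the sign of that term, then agree. *)
Lemma ext_d_annihilated al i x u v : M x ->
  \sum_j a j x * ev (w (fam al) j) x u = 0 ->
  \sum_j a j x * ev (w (fam al) j) x v = 0 ->
  ext_d (w (fam al) i) x u v = \sum_j wedge (w (fam al) j) (om j i) x u v.
Proof.
have [_ _ s0 s1] := hstr; move=> Mx.
have z0 b : \sum_j a j x * ev (w b j) x u = 0 -> \sum_j a j x * ev (w b j) x v = 0 ->
    \sum_j a j x * wedge (w b j) (w b i) x u v = 0.
  move=> hu hv; under eq_bigr do rewrite /wedge mulrBr !mulrA.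
  by rewrite sumrB -!mulr_suml hu hv !mul0r subrr.
move: al; apply: forall_ord2; rewrite ?fam0 ?fam1 => hu hv.
  by rewrite s0// z0// addr0.
by rewrite s1// z0// subr0.
Qed.

(** By the equations defining [P] and [Q], this is the vanishing of the 1-form
    [n^i (da_i - a_j omega_i^j)] at [x], with [n] the kernel vector. *)
Definition contracted (x : 'rV[R]_4) : Prop := forall v : 'rV[R]_4,
  \sum_i nn i x * (\sum_j P i j x * ev (w 0 j) x v + \sum_j Q i j x * ev (w 1 j) x v) = 0.

(** The left sides of the four conditions are, up to sign, the coefficients of this 1-form in the
    coframe; evaluation on the four dual vectors isolates them. *)
Lemma contractedP x : M x -> contracted x <->
  [/\ a 1 x * P 0 1 x - a 0 x * P 1 1 x = 0,
      a 0 x * P 1 0 x - a 1 x * P 0 0 x = 0,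
      a 1 x * Q 0 1 x - a 0 x * Q 1 1 x = 0 &
      a 0 x * Q 1 0 x - a 1 x * Q 0 0 x = 0].
Proof.
move=> Mx; split=> [h|[h1 h2 h3 h4] v]; last first.
  rewrite !sum_ord2 /ker_vec/=.
  move: (ev (w 0 0) x v) (ev (w 0 1) x v) (ev (w 1 0) x v) (ev (w 1 1) x v) => A B C D.
  transitivity ((a 1 x * P 0 1 x - a 0 x * P 1 1 x) * B - (a 0 x * P 1 0 x - a 1 x * P 0 0 x) * A
    + (a 1 x * Q 0 1 x - a 0 x * Q 1 1 x) * D - (a 0 x * Q 1 0 x - a 1 x * Q 0 0 x) * C).
    by ring.
  by rewrite h1 h2 h3 h4; ring.
have e0 be i j : ev (w 0 i) x (e be j x) = ((0 == be) && (i == j))%:R by rewrite -fam0 he.2.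
have e1 be i j : ev (w 1 i) x (e be j x) = ((1 == be) && (i == j))%:R by rewrite -fam1 he.2.
move: (h (e 0 0 x)) (h (e 0 1 x)) (h (e 1 0 x)) (h (e 1 1 x)).
rewrite !sum_ord2 /ker_vec/= !e0 !e1 /= => h1 h2 h3 h4.
by split; lra.
Qed.

Lemma contracted_derive x v : M x -> contracted x ->
  \sum_i nn i x * 'D_v (a i) x = \sum_i nn i x * \sum_j a j x * ev (om i j) x v.
Proof.
move=> Mx cx; apply/eqP; rewrite -subr_eq0 -sumrB; under eq_bigr do rewrite -mulrBr hpf//.
by rewrite cx.
Qed.

Lemma ext_dE u i x v v' : M x ->
  ext_d (w u i) x v v' = (v' *m 'D_v (w u i) x) 0 0 - (v *m 'D_v' (w u i) x) 0 0.
Proof.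
by move=> Mx; rewrite /ext_d !(derive_ev_cst _ (smooth_is_derive _ (sw u i) Mx)).
Qed.

Lemma sum_ker_vec x : \sum_i a i x * nn i x = 0.
Proof. by rewrite sum_ord2 /ker_vec/=; ring. Qed.

(** Differentiating [a_i omega_(al)^i(c *m Y) = 0] trades derivatives of the frame for derivatives
    of [a] and of the coframe. In the bracket the latter combine into an exterior derivative, to
    which the structure equations apply. *)
Lemma transversal_involutive : (forall x, M x -> contracted x) ->
  forall z (u v : 'rV[R]_2), M z ->
  (u *m 'D_(v *m Y z) Y z - v *m 'D_(u *m Y z) Y z <= Y z)%MS.
Proof.
move=> cM z u v Mz; have cz := cM z Mz; have [_ sa _ _] := hstr.
suff : transversal_distribution w a z (u *m 'D_(v *m Y z) Y z - v *m 'D_(u *m Y z) Y z).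
  by rewrite (transversal_distributionE he ha Mz).
apply/transversal_distributionP => al.
have annih (c : 'rV[R]_2) y : M y -> \sum_i a i y * ev (w (fam al) i) y (c *m Y y) = 0.
  move=> My; under eq_bigr do rewrite (ev_transversal_frame he)// mulrCA.
  by rewrite -mulr_sumr sum_ker_vec mulr0.
have sY := transversal_frame_smooth he oM sa.
pose rhs (c : 'rV[R]_2) d := - (\sum_i 'D_d (a i) z * (c 0 al * nn i z)) -
  \sum_i a i z * (c *m Y z *m 'D_d (w (fam al) i) z) 0 0.
have key c d : \sum_i a i z * ev (w (fam al) i) z (c *m 'D_d Y z) = rhs c d.
  have cY := is_derive_linear (@mulmx_continuous _ _ _ _ c) (smooth_is_derive d sY Mz).
  have := derive_annihilated Mz cY (annih c).
  under eq_bigr => i _.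
    have := is_derive_ev (smooth_is_derive d (sw (fam al) i) Mz) cY.
    move=> [_ /= ->].
    rewrite (ev_transversal_frame he)// mulrDr -[(_ *m w _ _ _) 0 0]/(ev (w (fam al) i) z _).
    over.
  by rewrite !big_split/= /rhs; lra.
under eq_bigr do rewrite evD -scaleN1r evZ mulN1r mulrBr.
rewrite sumrB.
transitivity (rhs u (v *m Y z) - rhs v (u *m Y z)).
  by congr (_ - _); exact: key.
rewrite /rhs.
have extE i := ext_d_annihilated i Mz (annih v z Mz) (annih u z Mz).
pose o i j := ev (om i j) z (u *m Y z); pose o' i j := ev (om i j) z (v *m Y z).
apply: (@bracket_cancellation _ (nn^~ z) (a^~ z) _ _ _ _ o o').
- move=> i; rewrite -(ext_dE _ _ _ _ Mz) extE; apply: eq_bigr => j _.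
  by rewrite /wedge !(ev_transversal_frame he).
- exact: contracted_derive.
- exact: contracted_derive.
Qed.

Lemma ev_frame_sum x (c : 'I_2 -> 'I_2 -> R) al i : M x ->
  ev (w (fam al) i) x (\sum_be \sum_j c be j *: e be j x) = c al i.
Proof.
move=> Mx; rewrite !sum_ord2 !evD !evZ !he.2//.
by move: al i; apply: forall_ord2; apply: forall_ord2; rewrite /=; ring.
Qed.

Lemma ev_bundle_form (p q : R) j i x v :
  ev (bundle_form w om a p q j i) x v = ev (om j i) x v +
    \sum_k torsion a i j k x * (p * ev (w 0 k) x v + q * ev (w 1 k) x v).
Proof.
rewrite /ev /bundle_form mulmxDr mulmx_sumr mxE summxE; congr (_ + _).
by apply: eq_bigr => k _; rewrite -scalemxAr mulmxDr -!scalemxAr !mxE.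
Qed.

(* The torsion is annihilated by a: [a_i a^i_jk = 0]. *)
Lemma bundle_form_contraction (p q : R) j x v :
  \sum_i a i x * ev (bundle_form w om a p q j i) x v = \sum_i a i x * ev (om j i) x v.
Proof.
rewrite !sum_ord2 !ev_bundle_form !sum_ord2 /torsion.
by move: j; apply: forall_ord2; rewrite /=; field.
Qed.

(** Contracting with [a] removes [p] and [q] from the connection. Since [a_i omega_(al)^i(Z)]
    vanishes on [M], the Leibniz rule moves the derivative from the components of [Z] to [a], whence
    the minus sign. *)
Lemma covariant_transversal (p q : R) al x v (Z : 'rV[R]_4 -> 'rV[R]_4) :
  M x -> smooth M Z -> (forall z, M z -> transversal_distribution w a z (Z z)) ->
  \sum_i a i x * ev (w (fam al) i) x (covariant w e (bundle_form w om a p q) x v Z) =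
  - \sum_i ev (w (fam al) i) x (Z x) *
      (\sum_j P i j x * ev (w 0 j) x v + \sum_j Q i j x * ev (w 1 j) x v).
Proof.
move=> Mx sZ ZD; under eq_bigr do rewrite ev_frame_sum//.
have := derive_annihilated Mx (smooth_is_derive v sZ Mx)
  (fun z Mz => (transversal_distributionP z (Z z)).1 (ZD z Mz) al).
under [X in _ -> _ = - X]eq_bigr do rewrite -hpf//.
have h0 := bundle_form_contraction p q 0 x v; have h1 := bundle_form_contraction p q 1 x v.
move: h0 h1; rewrite !sum_ord2 => h0 h1 h.
have := congr1 ( *%R^~ (ev (w (fam al) 0) x (Z x))) h0.
have := congr1 ( *%R^~ (ev (w (fam al) 1) x (Z x))) h1.
by move: h; rewrite /=; lra.
Qed.

Lemma parallel_contracted (p q : R) :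
  parallel_distribution M w e (bundle_form w om a p q) (transversal_distribution w a) <->
  forall x, M x -> contracted x.
Proof.
have [_ sa _ _] := hstr; split=> [par x Mx v|cM Z sZ ZD x v Mx].
  (* The single section [n^i e_i^1] already detects the whole condition: its components in the first
     block are exactly the kernel vector. *)
  pose Z (z : 'rV[R]_4) := (delta_mx 0 0 : 'rV[R]_2) *m Y z.
  have sZ : smooth M Z.
    by move=> k; apply: Ck_mulmx => //; [exact: Ck_cst|exact: (transversal_frame_smooth he oM sa)].
  have ZD z : M z -> transversal_distribution w a z (Z z).
    by move=> Mz; rewrite (transversal_distributionE he ha Mz) /= submxMl.
  have /transversal_distributionP/(_ 0) := par Z sZ ZD x v Mx.
  rewrite covariant_transversal// => /eqP; rewrite oppr_eq0 => /eqP h0; rewrite -[RHS]h0.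
  by apply: eq_bigr => i _; rewrite (ev_transversal_frame he)// mxE !eqxx mul1r.
apply/transversal_distributionP => al; rewrite covariant_transversal//.
(* Conversely, in each block the components of any section are a multiple of the kernel vector, so
   the contraction vanishes. *)
have [k kP] := ker_vecP ha Mx ((transversal_distributionP x (Z x)).1 (ZD x Mx) al).
under eq_bigr do rewrite kP -mulrA.
by rewrite -mulr_sumr (cM x Mx v) mulr0 oppr0.
Qed.

Lemma contracted_integrable : (forall x, M x -> contracted x) ->
  Defs.integrable 1 M (transversal_distribution w a).
Proof.
have [_ sa _ _] := hstr; move=> cM x Mx.
have [N [s [oN N0 sN s0 sP]]] := involutive_surface oM (transversal_frame_smooth he oM sa)
  (transversal_frame_free he ha) (transversal_involutive cM) Mx.
exists N, s; split=> // h /sP[Ms rk im]; split=> //.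
by rewrite (transversal_distributionE he ha Ms).
Qed.

End Web.

Theorem theorem5 (R : realType) (M : set 'rV[R]_4)
    (lam : 'I_3 -> distribution R)
    (w : 'I_3 -> 'I_2 -> form1 R)
    (e : 'I_2 -> 'I_2 -> 'rV[R]_4 -> 'rV[R]_4)
    (om : 'I_2 -> 'I_2 -> form1 R)
    (a : 'I_2 -> 'rV[R]_4 -> R)
    (b : 'I_2 -> 'I_2 -> 'I_2 -> 'I_2 -> 'rV[R]_4 -> R)
    (P Q : 'I_2 -> 'I_2 -> 'rV[R]_4 -> R)
    (hweb : web322 M lam)
    (hw : admissible_coframe M lam w)
    (he : dual_frame M w e)
    (hstr : structure_equations M w om a)
    (hcurv : curvature_equations M w om b)
    (hpf : pfaffian_derivatives M w om a P Q)
    (ha : forall x, M x -> exists i, a i x != 0)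
    (p q : R) :
  geodesicly_parallel M w e (bundle_form w om a p q)
    (transversal_distribution w a)
  <->
  (forall x, M x ->
     [/\ a 1 x * P 0 1 x - a 0 x * P 1 1 x = 0,
         a 0 x * P 1 0 x - a 1 x * P 0 0 x = 0,
         a 1 x * Q 0 1 x - a 0 x * Q 1 1 x = 0 &
         a 0 x * Q 1 0 x - a 1 x * Q 0 0 x = 0]).
Proof.
have [oM _ _] := hweb; have [sw _ _] := hw.
split=> [[_ /(parallel_contracted oM sw he hstr hpf ha) h] x Mx|h].
  exact/(contractedP he Mx)/h.
have cM x (Mx : M x) := (contractedP he Mx).2 (h x Mx).
by split; [exact: (contracted_integrable oM sw he hstr hpf ha)
          |exact/(parallel_contracted oM sw he hstr hpf ha)].
Qed.
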